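(* Let $\zeta:\mathbf Z\to M$ be an AV-bundle, let $\theta_{\mathbf Z}$ be the Liouville affine form (an affine 1-form, i.e. a section of the phase bundle of the AV-bundle $\zeta_{\mathsf C\mathbf Z}:\mathsf C\mathbf Z\to\mathsf P\mathbf Z$), and let $\omega_{\mathbf Z}$ be the canonical symplectic form on $\mathsf P\mathbf Z$. Then $$\boldsymbol d\,\theta_{\mathbf Z}=\omega_{\mathbf Z}.$$
   Context: An AV-bundle $\zeta:\mathbf Z\to M$ is a rank-one affine bundle modelled on the trivial bundle $M\times\mathbb R$ (equivalently a principal $(\mathbb R,+)$-bundle). The difference of two sections is a function on $M$. Phase bundle: on pairs $(m,\sigma)$, $m\in M$, $\sigma$ a section of $\zeta$, put $(m,\sigma)\sim(m',\sigma')$ iff $m=m'$ and $\mathrm d(\sigma'-\sigma)(m)=0$. The class of $(m,\sigma)$ is denoted $\boldsymbol d\sigma(m)$ (or $\boldsymbol d_m\sigma$), and the set of classes is $\mathsf P\mathbf Z$; it is an affine bundle over $M$ modelled on $T^*M$ with $\boldsymbol d\sigma_2(m)-\boldsymbol d\sigma_1(m)=\mathrm d(\sigma_2-\sigma_1)(m)$. Sections of $\mathsf P\mathbf Z\to M$ are called affine 1-forms (for $\mathbf Z$). The differential of an affine 1-form $\alpha$ is the ordinary 2-form $\boldsymbol d\alpha:=\mathrm d(\alpha-\boldsymbol d\sigma)$ on $M$, which is independent of the (local) section $\sigma$ of $\zeta$. The same definitions apply to any AV-bundle over any base. Canonical symplectic form: a section $\sigma$ of $\zeta$ gives an isomorphism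 $I_{\boldsymbol d\sigma}:\mathsf P\mathbf Z\to T^*M$, $p\mapsto p-\boldsymbol d\sigma(m)$ for $p$ over $m$; $\omega_{\mathbf Z}:=I_{\boldsymbol d\sigma}^*\omega_M$, which is independent of $\sigma$, where $\omega_M=\mathrm d\theta_M$ and $\theta_M=p_a\,\mathrm dx^a$ is the Liouville 1-form of $T^*M$. Contact bundle: $\mathsf C\mathbf Z$ is the bundle of first jets $\mathrm c\sigma(m)$ of sections $\sigma$ of $\zeta$. The projection $\zeta_{\mathsf C\mathbf Z}:\mathsf C\mathbf Z\to\mathsf P\mathbf Z$, $\mathrm c\sigma(m)\mapsto\boldsymbol d\sigma(m)$, is an AV-bundle with $\mathrm c\sigma(m)+r=\mathrm c(\sigma+r)(m)$ for $r\in\mathbb R$. Let $\mu:\mathsf C\mathbf Z\to\mathbf Z$, $\mu(\mathrm c\sigma(m))=\sigma(m)$. For a section $\sigma$ of $\zeta$, its pull-back $\mu^*\sigma$ is the section of $\zeta_{\mathsf C\mathbf Z}$ that assigns to $p\in\mathsf P_m\mathbf Z$ the unique point of $\zeta_{\mathsf C\mathbf Z}^{-1}(p)$ mapped by $\mu$ to $\sigma(m)$. Liouville affine form: $\theta_{\mathbf Z}$ is the affine 1-form for the AV-bundle $\zeta_{\mathsf C\mathbf Z}$ (a section over $\mathsf P\mathbf Z$ of the phase bundle of $\zeta_{\mathsf C\mathbf Z}$) given by $\theta_{\mathbf Z}(\boldsymbol d\sigma(m))=\boldsymbol d(\mu^*\sigma)(\boldsymbol d\sigma(m))$ for every section $\sigma$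 of $\zeta$ and $m\in M$. *)

(* Defs.v *)
From HB Require Import structures.
From mathcomp Require Import all_boot all_order all_algebra.
From mathcomp Require Import all_classical all_reals topology normedtype landau derive.

Set Implicit Arguments.
Unset Strict Implicit.
Unset Printing Implicit Defensive.

Import Order.TTheory GRing.Theory Num.Theory numFieldNormedType.Exports.
Local Open Scope classical_set_scope.
Local Open Scope ring_scope.

Lemma near_eq_differentiable (R : numFieldType) (V W : normedModType R)
    (f g : V -> W) (x : V) :
  {near x, f =1 g} -> differentiable g x -> differentiable f x.
Proof.
move=> fg dg.
have fgx := nbhs_singleton fg.
have dc : continuous ('d g x) by exact: diff_continuous.
have H : f \o shift x = cst (f x) + 'd g x +o_ (0 : V) id.
  apply/eqaddoP => e e0.
  have /eqaddoP/(_ e e0) He := diff_locally dg.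
  have fg0 : \forall h \near (0:V), f (h + x) = g (h + x).
    by rewrite (near_shift x); near=> z; rewrite /= sub0r subrK; near: z.
  near=> h.
  have -> : ((f \o shift x) - (cst (f x) + 'd g x)) h = ((g \o shift x) - (cst (g x) + 'd g x)) h.
    rewrite /= fgx. congr (_ - _). by near: h.
  by near: h.
apply/diff_locallyP; split; rewrite (diff_unique dc H) //.
Unshelve. all: by end_near. Qed.

Section Smooth.
Context {R : realType}.
Implicit Types n m : nat.

Definition pd n (a : 'I_n) (f : 'rV[R]_n -> R) : 'rV[R]_n -> R :=
  fun x => 'D_(delta_mx 0 a) f x.

(* All iterated partial derivatives exist and are differentiable at every point
   of U, i.e. f is C^oo on U when U is open; f is unconstrained outside U. *)
Definition smooth_on n (U : set 'rV[R]_n) (f : 'rV[R]_n -> R) :=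
  forall (s : seq 'I_n) x, U x -> differentiable (foldr (@pd n) f s) x.

Lemma smooth_on_diff n U (f : 'rV[R]_n -> R) x : smooth_on U f -> U x -> differentiable f x.
Proof. by move=> /(_ [::]); apply. Qed.

Lemma smooth_on_pd n U (f : 'rV[R]_n -> R) a : smooth_on U f -> smooth_on U (pd a f).
Proof. by move=> sf s x; have := sf (rcons s a) x; rewrite foldr_rcons. Qed.

Lemma smooth_on_sub n (U V : set 'rV[R]_n) f : V `<=` U -> smooth_on U f -> smooth_on V f.
Proof. by move=> VU sf s x /VU; exact: sf. Qed.

Lemma open_eq_near n (U : set 'rV[R]_n) (f g : 'rV[R]_n -> R) x :
  open U -> U x -> {in U, f =1 g} -> {near x, f =1 g}.
Proof.
move=> oU Ux fg; have := open_nbhs_nbhs (conj oU Ux).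
by apply: filterS => y Uy; apply: fg; rewrite inE.
Qed.

Lemma pd_near n (f g : 'rV[R]_n -> R) a x : {near x, f =1 g} -> pd a f x = pd a g x.
Proof. exact: near_eq_derive. Qed.

(* A function is smooth as soon as it belongs to a family of differentiable
   functions that is stable under partial derivatives. *)
Lemma smooth_on_coind n (U : set 'rV[R]_n) (S : set ('rV[R]_n -> R)) :
  open U ->
  (forall g x, S g -> U x -> differentiable g x) ->
  (forall g a, S g -> exists2 h, S h & {in U, pd a g =1 h}) ->
  forall f g, S g -> {in U, f =1 g} -> smooth_on U f.
Proof.
move=> oU Sd Sp f g Sg fg s; elim/last_ind: s f g Sg fg => [|s a IH] f g Sg fg.
  move=> x Ux /=; apply: near_eq_differentiable (Sd _ _ Sg Ux).
  exact: open_eq_near oU Ux fg.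
move=> x Ux; rewrite foldr_rcons.
have [h Sh gh] := Sp _ a Sg.
apply: (IH _ h Sh _ x Ux) => y yU; rewrite -gh //.
by apply: pd_near; move: yU; rewrite inE => /(open_eq_near oU); apply.
Qed.

Lemma smooth_on_eq n (U : set 'rV[R]_n) f g :
  open U -> {in U, f =1 g} -> smooth_on U g -> smooth_on U f.
Proof.
move=> oU fg sg; apply: (@smooth_on_coind n U [set h | smooth_on U h]) fg => //=.
- by move=> h x /smooth_on_diff; apply.
- by move=> h a sh; exists (pd a h) => //; exact: smooth_on_pd.
Qed.

Lemma smooth_on_near n (U : set 'rV[R]_n) f :
  (forall x, U x -> exists V, [/\ V x & smooth_on V f]) -> smooth_on U f.
Proof. by move=> H s x /H[V [Vx sf]]; exact: sf. Qed.

Lemma pd_cst n (a : 'I_n) (c : R) x : pd a (cst c) x = 0.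
Proof. exact: derive_cst. Qed.

Lemma smooth_on_cst n (U : set 'rV[R]_n) (c : R) : smooth_on U (cst c).
Proof.
suff : smooth_on setT (cst c : 'rV[R]_n -> R) by exact: smooth_on_sub.
apply: (@smooth_on_coind n setT [set f | exists c, f = cst c] openT) => //=; last by exists c.
  by move=> _ x [d ->] _; exact: differentiable_cst.
move=> _ a [d ->]; exists (cst 0); first by exists 0.
by move=> x _; rewrite pd_cst.
Qed.

Lemma pd_coord n (a b : 'I_n) x : pd a (fun y : 'rV[R]_n => y 0 b) x = (a == b)%:R.
Proof.
have := derive_id x (delta_mx 0 a : 'rV[R]_n).
rewrite derive_mx; last exact: derivable_id.
move=> /(congr1 (fun A : 'rV[R]_n => A 0 b)); rewrite mxE => E; rewrite /pd E.
by rewrite !mxE eqxx /= eq_sym.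
Qed.

Lemma smooth_on_coord n (U : set 'rV[R]_n) b : smooth_on U (fun y : 'rV[R]_n => y 0 b).
Proof.
suff : smooth_on setT (fun y : 'rV[R]_n => y 0 b) by exact: smooth_on_sub.
apply: (@smooth_on_coind n setT
  [set f | smooth_on setT f \/ f = (fun y : 'rV[R]_n => y 0 b)] openT) => //=; last by right.
  by move=> g x [/smooth_on_diff H|->] _; [exact: H|exact: differentiable_coord].
move=> g a [sg|->]; first by exists (pd a g) => //; left; exact: smooth_on_pd.
exists (cst (a == b)%:R); first by left; exact: smooth_on_cst.
by move=> x _; rewrite pd_coord.
Qed.

Lemma diff_pd n (f : 'rV[R]_n -> R) x v : differentiable f x ->
  'd f x v = \sum_a v 0 a * pd a f x.
Proof.
move=> df; rewrite {1}(row_sum_delta v) linear_sum; apply: eq_bigr => a _.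
by rewrite linearZ /= /pd deriveE.
Qed.

Lemma differentiable_row n m (G : 'rV[R]_n -> 'rV[R]_m) x :
  (forall c, differentiable (fun y => G y 0 c) x) -> differentiable G x.
Proof.
move=> dG; have -> : G = \sum_c (fun y => G y 0 c *: (delta_mx 0 c : 'rV[R]_m)).
  by apply/funext => y; rewrite fct_sumE; exact: row_sum_delta.
by apply: differentiable_sum => c; exact: differentiableZl.
Qed.

Lemma pd_comp n m (G : 'rV[R]_n -> 'rV[R]_m) (h : 'rV[R]_m -> R) a x :
  (forall c, differentiable (fun y => G y 0 c) x) -> differentiable h (G x) ->
  pd a (h \o G) x = \sum_c pd c h (G x) * pd a (fun y => G y 0 c) x.
Proof.
move=> dG dh; have dG' := differentiable_row dG.
rewrite /pd deriveE; last exact: differentiable_comp.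
rewrite diff_comp //= diff_pd //; apply: eq_bigr => c _.
rewrite mulrC -deriveE // derive_mx ?mxE //; exact: diff_derivable.
Qed.

Inductive Cgen n (U : set 'rV[R]_n) : set ('rV[R]_n -> R) :=
| Cgen_base h : smooth_on U h -> Cgen U h
| Cgen_comp m (V : set 'rV[R]_m) (G : 'rV[R]_n -> 'rV[R]_m) h :
    {homo G : x / U x >-> V x} -> (forall c, smooth_on U (fun y => G y 0 c)) ->
    smooth_on V h -> Cgen U (h \o G)
| Cgen_add f g : Cgen U f -> Cgen U g -> Cgen U (f + g)
| Cgen_mul f g : Cgen U f -> Cgen U g -> Cgen U (f * g).

Lemma Cgen_diff n (U : set 'rV[R]_n) f x : Cgen U f -> U x -> differentiable f x.
Proof.
move=> Uf Ux; elim: Uf => [h|m V G h GUV sG sh|g h _ dg _ dh|g h _ dg _ dh].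
- by move/smooth_on_diff; apply.
- apply: differentiable_comp; last by apply: smooth_on_diff sh _; exact: GUV.
  by apply: differentiable_row => c; exact: smooth_on_diff (sG c) Ux.
- exact: differentiableD.
- exact: differentiableM.
Qed.

Lemma pdD n (f g : 'rV[R]_n -> R) a x : differentiable f x -> differentiable g x ->
  pd a (f + g) x = pd a f x + pd a g x.
Proof. by move=> df dg; rewrite /pd deriveD //; exact: diff_derivable. Qed.

Lemma pdM n (f g : 'rV[R]_n -> R) a x : differentiable f x -> differentiable g x ->
  pd a (f * g) x = f x * pd a g x + g x * pd a f x.
Proof. by move=> df dg; rewrite /pd deriveM //; exact: diff_derivable. Qed.

Lemma Cgen_smooth n (U : set 'rV[R]_n) f : open U -> Cgen U f -> smooth_on U f.
Proof.
move=> oU Uf; apply: (@smooth_on_coind n U (Cgen U) oU _ _ f f Uf) => // {f Uf}.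
  by move=> g x; exact: Cgen_diff.
move=> k a; elim=> {k} [h sh|m V G h GUV sG sh
  |g h Ug [g' Ug' gg'] Uh [h' Uh' hh']|g h Ug [g' Ug' gg'] Uh [h' Uh' hh']].
- by exists (pd a h) => //; apply: Cgen_base; exact: smooth_on_pd.
- exists (\sum_c ((pd c h \o G) * pd a (fun y => G y 0 c))).
    apply: (@big_ind _ (Cgen U)) => [|? ?|c _].
    + by apply: Cgen_base; exact: smooth_on_cst.
    + exact: Cgen_add.
    + apply: Cgen_mul; last by apply: Cgen_base; exact: smooth_on_pd.
      by apply: Cgen_comp GUV sG _; exact: smooth_on_pd.
  move=> x; rewrite inE => Ux; rewrite fct_sumE pd_comp //.
    by move=> c; exact: smooth_on_diff (sG c) Ux.
  by apply: smooth_on_diff sh _; exact: GUV.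
- exists (g' + h'); first exact: Cgen_add.
  move=> x xU; rewrite pdD ?gg' ?hh' //; apply: Cgen_diff; eauto; exact: set_mem.
- exists (g * h' + h * g').
    by apply: Cgen_add; apply: Cgen_mul.
  move=> x xU; rewrite pdM ?gg' ?hh' //; apply: Cgen_diff; eauto; exact: set_mem.
Qed.

Lemma smooth_onD n (U : set 'rV[R]_n) f g : open U ->
  smooth_on U f -> smooth_on U g -> smooth_on U (fun x => f x + g x).
Proof.
move=> oU sf sg; apply: (@Cgen_smooth n U (f + g)) => //.
by apply: Cgen_add; exact: Cgen_base. Qed.

Lemma smooth_onM n (U : set 'rV[R]_n) f g : open U ->
  smooth_on U f -> smooth_on U g -> smooth_on U (fun x => f x * g x).
Proof.
move=> oU sf sg; apply: (@Cgen_smooth n U (f * g)) => //.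
by apply: Cgen_mul; exact: Cgen_base. Qed.

Lemma smooth_onN n (U : set 'rV[R]_n) f : open U ->
  smooth_on U f -> smooth_on U (fun x => - f x).
Proof.
move=> oU sf; rewrite (_ : (fun x => _) = (fun x => cst (-1) x * f x)).
  by apply: smooth_onM => //; exact: smooth_on_cst.
by apply/funext => x; rewrite mulN1r.
Qed.

Lemma smooth_onB n (U : set 'rV[R]_n) f g : open U ->
  smooth_on U f -> smooth_on U g -> smooth_on U (fun x => f x - g x).
Proof. by move=> oU sf sg; apply: smooth_onD => //; exact: smooth_onN. Qed.

Lemma smooth_on_sum n (U : set 'rV[R]_n) (I : finType) (f : I -> 'rV[R]_n -> R) : open U ->
  (forall i, smooth_on U (f i)) -> smooth_on U (fun x => \sum_i f i x).
Proof.
move=> oU sf; rewrite (_ : (fun x => _) = \sum_i f i); last first.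
  by apply/funext => x; rewrite fct_sumE.
apply: (@big_ind _ (smooth_on U)) => [|? ? ? ?|//]; first exact: smooth_on_cst.
exact: smooth_onD.
Qed.

Lemma smooth_on_comp n m (U : set 'rV[R]_n) (V : set 'rV[R]_m) G h :
  open U -> {homo G : x / U x >-> V x} -> (forall c, smooth_on U (fun y => G y 0 c)) ->
  smooth_on V h -> smooth_on U (h \o G).
Proof. by move=> oU GUV sG sh; apply: Cgen_smooth => //; exact: Cgen_comp GUV sG sh. Qed.

End Smooth.

(* f \o phi^-1 on phi @` D (for phi injective on D), and 0 elsewhere. *)
Definition localrep {R : realType} {T : Type} {n : nat} (D : set T) (phi : T -> 'rV[R]_n)
    (f : T -> R) : 'rV[R]_n -> R :=
  fun y => xget 0 [set f x | x in D `&` phi @^-1` [set y]].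

Lemma localrepE {R : realType} {T : Type} {n : nat} (D : set T) (phi : T -> 'rV[R]_n)
    (f : T -> R) x :
  set_inj D phi -> D x -> localrep D phi f (phi x) = f x.
Proof.
move=> phiI xD; rewrite /localrep.
case: xgetP => [r _ [y [yD phiy] <-]|/(_ (f x))[]]; last by exists x.
by rewrite (phiI y x) ?inE.
Qed.

(* A set with a smooth atlas modelled on R^n.  The topology is the one induced by
   the charts (below); Hausdorffness and second countability are not part of
   the record, since no construction depends on them. *)
Record atlas (R : realType) (n : nat) := Atlas {
  carrier :> Type;
  chart : Type;
  dom : chart -> set carrier;
  coord : chart -> carrier -> 'rV[R]_n;
  dom_cover : forall m, exists i, dom i m;
  coord_inj : forall i, set_inj (dom i) (coord i);
  overlap_open : forall i j, open (coord i @` (dom i `&` dom j));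
  transition_smooth : forall i j a,
    smooth_on (coord i @` (dom i `&` dom j))
            (localrep (dom i) (coord i) (fun m => coord j m 0 a)) }.

Section AtlasTopology.
Context {R : realType} {n : nat} {M : atlas R n}.

HB.instance Definition _ := gen_eqMixin (carrier M).
HB.instance Definition _ := gen_choiceMixin (carrier M).

Definition atlas_open : set (set M) :=
  [set U | forall i : chart M, open (coord i @` (U `&` dom i))].

Lemma coord_injP (i : chart M) x y : dom i x -> dom i y -> coord i x = coord i y -> x = y.
Proof. by move=> xi yi; apply: (@coord_inj _ _ M i); rewrite inE. Qed.

Fact atlas_openT : atlas_open setT.
Proof. by move=> i; rewrite setTI -[dom i]setIid; exact: overlap_open. Qed.

Fact atlas_openI : setI_closed atlas_open.
Proof.
move=> U V oU oV i; have := openI (oU i) (oV i); congr open.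
rewrite eqEsubset; split=> [y [[u [uU ui] <-] [v [vV vi]]]|_ [u [[uU uV] ui] <-]].
  by move=> /(coord_injP vi ui) vu; exists u => //; split=> //; split=> //; rewrite -vu.
by split; exists u.
Qed.

Fact atlas_open_bigU (I : Type) (f : I -> set M) :
  (forall i, atlas_open (f i)) -> atlas_open (\bigcup_i f i).
Proof.
move=> of_ i; rewrite setI_bigcupl image_bigcup; apply: bigcup_open => k _; exact: of_.
Qed.

HB.instance Definition _ := @isOpenTopological.Build (carrier M)
  atlas_open atlas_openT atlas_openI atlas_open_bigU.

Lemma atlas_openE (U : set M) : open U = atlas_open U.
Proof. by []. Qed.

Lemma dom_open (i : chart M) : open (dom i).
Proof. by move=> j; rewrite setIC; exact: overlap_open. Qed.

Lemma img_open (i : chart M) (U : set M) : open U -> open (coord i @` (U `&` dom i)).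
Proof. exact. Qed.

End AtlasTopology.

Section Functions.
Context {R : realType} {n : nat} {M : atlas R n}.
Implicit Types (i j : chart M) (U V : set M) (f g : M -> R) (m : M).

Definition rep i f : 'rV[R]_n -> R := localrep (dom i) (coord i) f.

(* Smoothness of f on U, meant for open U. *)
Definition smooth_fun U f := forall i, smooth_on (coord i @` (U `&` dom i)) (rep i f).

Definition smooth_at f m := exists U, [/\ open U, U m & smooth_fun U f].

(* The partial derivative of f at m in the chart i (for m in its domain). *)
Definition dpart i a f m : R := pd a (rep i f) (coord i m).

(* d f (m) = 0. *)
Definition dzero f m := forall i, dom i m -> forall a, dpart i a f m = 0.

Lemma repE i f m : dom i m -> rep i f (coord i m) = f m.
Proof. by move=> mi; apply: localrepE => //; exact: coord_inj. Qed.

Lemma smooth_fun_sub U V f : V `<=` U -> smooth_fun U f -> smooth_fun V f.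
Proof.
by move=> VU sf i; apply: smooth_on_sub (sf i); apply: image_subset => m [/VU].
Qed.

Lemma smooth_fun_near U f : (forall m, U m -> smooth_at f m) -> smooth_fun U f.
Proof.
move=> H i; apply: smooth_on_near => _ [m [Um mi] <-].
have [V [oV Vm sf]] := H m Um; exists (coord i @` (V `&` dom i)).
by split; [exists m|exact: sf].
Qed.

Lemma smooth_fun_at U f m : open U -> U m -> smooth_fun U f -> smooth_at f m.
Proof. by move=> oU Um sf; exists U. Qed.

Lemma rep_eq_in i U f g : {in U, f =1 g} -> {in coord i @` (U `&` dom i), rep i f =1 rep i g}.
Proof.
by move=> fg y; rewrite inE => -[m [Um mi] <-]; rewrite !repE // fg // inE.
Qed.

Lemma smooth_fun_ext U f g : open U -> {in U, f =1 g} -> smooth_fun U g -> smooth_fun U f.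
Proof.
by move=> oU fg sg i; apply: smooth_on_eq (rep_eq_in fg) (sg i); exact: img_open.
Qed.

Lemma smooth_fun_cst U (c : R) : open U -> smooth_fun U (cst c).
Proof.
move=> oU i; apply: (@smooth_on_eq _ _ _ _ (cst c)); [exact: img_open| |exact: smooth_on_cst].
by move=> y; rewrite inE => -[m [_ mi] <-]; rewrite repE.
Qed.

Lemma smooth_funD U f g : open U -> smooth_fun U f -> smooth_fun U g ->
  smooth_fun U (fun m => f m + g m).
Proof.
move=> oU sf sg i; apply: (@smooth_on_eq _ _ _ _ (fun y => rep i f y + rep i g y)).
- exact: img_open.
- by move=> y; rewrite inE => -[m [_ mi] <-]; rewrite !repE.
- by apply: smooth_onD => //; exact: img_open.
Qed.

Lemma smooth_funM U f g : open U -> smooth_fun U f -> smooth_fun U g ->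
  smooth_fun U (fun m => f m * g m).
Proof.
move=> oU sf sg i; apply: (@smooth_on_eq _ _ _ _ (fun y => rep i f y * rep i g y)).
- exact: img_open.
- by move=> y; rewrite inE => -[m [_ mi] <-]; rewrite !repE.
- by apply: smooth_onM => //; exact: img_open.
Qed.

Lemma smooth_funB U f g : open U -> smooth_fun U f -> smooth_fun U g ->
  smooth_fun U (fun m => f m - g m).
Proof.
move=> oU sf sg.
apply: (@smooth_fun_ext _ _ (fun m => f m + cst (-1) m * g m)) => //.
  by move=> m _; rewrite mulN1r.
by apply: smooth_funD => //; apply: smooth_funM => //; exact: smooth_fun_cst.
Qed.

Lemma smooth_fun_sum U (I : finType) (f : I -> M -> R) : open U ->
  (forall k, smooth_fun U (f k)) -> smooth_fun U (fun m => \sum_k f k m).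
Proof.
move=> oU sf; rewrite (_ : (fun m => _) = \sum_k f k); last first.
  by apply/funext => x; rewrite fct_sumE.
apply: (@big_ind _ (smooth_fun U)) => [|? ? ? ?|//]; first exact: smooth_fun_cst.
exact: smooth_funD.
Qed.

Lemma coord_smooth j a : smooth_fun (dom j) (fun m => coord j m 0 a).
Proof. by move=> i; rewrite setIC; exact: transition_smooth. Qed.

Lemma smooth_in_chart j U f : open U -> U `<=` dom j ->
  smooth_on (coord j @` U) (rep j f) -> smooth_fun U f.
Proof.
move=> oU Uj sf i.
pose T y : 'rV[R]_n := \row_a rep i (fun m => coord j m 0 a) y.
have TE m : dom i m -> T (coord i m) = coord j m.
  by move=> mi; apply/rowP => a; rewrite mxE repE.
apply: (@smooth_on_eq _ _ _ _ (rep j f \o T)); first exact: img_open.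
  by move=> y; rewrite inE => -[m [Um mi] <-]; rewrite /= TE // !repE //; exact: Uj.
apply: smooth_on_comp sf; first exact: img_open.
  by move=> _ [m [Um mi] <-]; rewrite TE //; exists m.
move=> c; rewrite (_ : (fun y => _) = rep i (fun m => coord j m 0 c)).
  exact: smooth_fun_sub Uj (@coord_smooth j c) i.
by apply/funext => y; rewrite mxE.
Qed.

Lemma rep_near i U f g m : open U -> U m -> dom i m -> {in U, f =1 g} ->
  {near coord i m, rep i f =1 rep i g}.
Proof.
move=> oU Um mi /(@rep_eq_in i) fg; apply: open_eq_near fg; first exact: img_open.
by exists m.
Qed.

Lemma dpart_near i a U f g m : open U -> U m -> dom i m -> {in U, f =1 g} ->
  dpart i a f m = dpart i a g m.
Proof. by move=> oU Um mi fg; apply: pd_near; exact: rep_near fg. Qed.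

Lemma smooth_at_rep i f m : dom i m -> smooth_at f m -> differentiable (rep i f) (coord i m).
Proof. by move=> mi [U [oU Um /(_ i)/smooth_on_diff]]; apply; exists m. Qed.

Lemma dpart_chain i j a f m : dom i m -> dom j m -> smooth_at f m ->
  dpart i a f m = \sum_b dpart j b f m * dpart i a (fun x => coord j x 0 b) m.
Proof.
move=> mi mj sf; pose T y : 'rV[R]_n := \row_a rep i (fun m => coord j m 0 a) y.
have TE x : dom i x -> T (coord i x) = coord j x.
  by move=> xi; apply/rowP => c; rewrite mxE repE.
have Tc c : (fun y => T y 0 c) = rep i (fun m => coord j m 0 c).
  by apply/funext => y; rewrite mxE.
rewrite /dpart (@pd_near _ _ _ (rep j f \o T)).
  rewrite pd_comp ?TE //; last exact: smooth_at_rep.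
    by apply: eq_bigr => b _; rewrite Tc.
  move=> c; rewrite Tc; apply: smooth_at_rep => //.
  by exists (dom j); split; [exact: dom_open| |exact: coord_smooth].
apply: (@open_eq_near _ _ (coord i @` (dom j `&` dom i))).
- by apply: img_open; exact: dom_open.
- by exists m.
- by move=> y; rewrite inE => -[x [xj xi] <-]; rewrite /= TE // !repE.
Qed.

Lemma dzero_chart j f m : dom j m -> smooth_at f m ->
  (forall a, dpart j a f m = 0) -> dzero f m.
Proof.
move=> mj sf f0 i mi a; rewrite (dpart_chain a mi mj sf) big1 // => b _.
by rewrite f0 mul0r.
Qed.

Lemma smooth_at_cst m (c : R) : smooth_at (cst c) m.
Proof. by exists setT; split; [exact: openT| |exact: smooth_fun_cst openT]. Qed.

Lemma smooth_atI f g m : smooth_at f m -> smooth_at g m ->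
  exists U, [/\ open U, U m, smooth_fun U f & smooth_fun U g].
Proof.
move=> [U [oU Um sf]] [V [oV Vm sg]]; exists (U `&` V); split => //.
- exact: openI.
- exact: smooth_fun_sub sf.
- exact: smooth_fun_sub sg.
Qed.

Lemma smooth_atD f g m : smooth_at f m -> smooth_at g m -> smooth_at (fun x => f x + g x) m.
Proof.
by move=> sf /(smooth_atI sf)[U [oU Um ? ?]]; exists U; split=> //; exact: smooth_funD.
Qed.

Lemma smooth_atB f g m : smooth_at f m -> smooth_at g m -> smooth_at (fun x => f x - g x) m.
Proof.
by move=> sf /(smooth_atI sf)[U [oU Um ? ?]]; exists U; split=> //; exact: smooth_funB.
Qed.

Lemma dpartD i a f g m : dom i m -> smooth_at f m -> smooth_at g m ->
  dpart i a (fun x => f x + g x) m = dpart i a f m + dpart i a g m.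
Proof.
move=> mi sf sg; rewrite -pdD; [|exact: smooth_at_rep..].
apply: pd_near; apply: (@open_eq_near _ _ (coord i @` (setT `&` dom i))).
- by apply: img_open; exact: openT.
- by exists m.
- by move=> y; rewrite inE => -[x [_ xi] <-]; rewrite fctE !repE.
Qed.

Lemma dpart_cst i a (c : R) m : dom i m -> dpart i a (cst c) m = 0.
Proof.
move=> mi; rewrite -(pd_cst a c (coord i m)).
apply: pd_near; apply: (@open_eq_near _ _ (coord i @` (setT `&` dom i))).
- by apply: img_open; exact: openT.
- by exists m.
- by move=> y; rewrite inE => -[x [_ xi] <-]; rewrite repE.
Qed.

Lemma dpartB i a f g m : dom i m -> smooth_at f m -> smooth_at g m ->
  dpart i a (fun x => f x - g x) m = dpart i a f m - dpart i a g m.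
Proof.
move=> mi sf sg; apply/eqP; rewrite eq_sym subr_eq; apply/eqP.
rewrite -dpartD //; last exact: smooth_atB.
suff E : (fun x => f x - g x + g x) = f by exact: (esym (congr1 (fun h => dpart i a h m) E)).
by apply/funext => x; rewrite subrK.
Qed.

Lemma dpart_coord i a b m : dom i m -> dpart i a (fun x => coord i x 0 b) m = (a == b)%:R.
Proof.
move=> mi; rewrite -(pd_coord a b (coord i m)).
apply: pd_near; apply: (@open_eq_near _ _ (coord i @` (setT `&` dom i))).
- by apply: img_open; exact: openT.
- by exists m.
- by move=> y; rewrite inE => -[x [_ xi] <-]; rewrite repE.
Qed.

Lemma dpart_smooth i a U f : open U -> U `<=` dom i -> smooth_fun U f ->
  smooth_fun U (dpart i a f).
Proof.
move=> oU Ui sf; apply: (@smooth_in_chart i) => //.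
have UE : coord i @` U = coord i @` (U `&` dom i) by rewrite setIidl.
apply: (@smooth_on_eq _ _ _ _ (pd a (rep i f))); first by rewrite UE; exact: img_open.
  by move=> y; rewrite inE => -[m Um <-]; rewrite repE //; exact: Ui.
by rewrite UE; exact: smooth_on_pd.
Qed.

End Functions.

(* A principal (R, +)-bundle, i.e. an affine bundle modelled on M * R: avadd is the
   action and avsub z z' the difference z - z' of two points of one fibre (it is
   unconstrained on points of different fibres).  A local trivialisation is given
   by its zero section tsec k over the open set tdom k, which corresponds to the map
   (m, r) |-> avadd (tsec k m) r; the transition functions have to be smooth. *)
Record avbundle {R : realType} {n : nat} (M : atlas R n) := AVBundle {
  total :> Type;
  proj : total -> M;
  avadd : total -> R -> total;
  avsub : total -> total -> R;
  proj_avadd : forall z r, proj (avadd z r) = proj z;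
  avadd0 : forall z, avadd z 0 = z;
  avaddA : forall z r s, avadd (avadd z r) s = avadd z (r + s);
  avsubK : forall z z', proj z = proj z' -> avadd z' (avsub z z') = z;
  avaddK : forall z r, avsub (avadd z r) z = r;
  triv : Type;
  tdom : triv -> set M;
  tsec : triv -> M -> total;
  tdom_open : forall k, open (tdom k);
  tdom_cover : forall m, exists k, tdom k m;
  proj_tsec : forall k m, tdom k m -> proj (tsec k m) = m;
  tsec_smooth : forall k l, smooth_fun (tdom k `&` tdom l)
    (fun m => avsub (tsec k m) (tsec l m)) }.

(* Smooth local sections; the values outside the open domain are irrelevant. *)
Record lsection {R : realType} {n : nat} {M : atlas R n} (Z : avbundle M) := LSection {
  sdom : set M;
  sfun :> M -> Z;
  sdom_open : open sdom;
  proj_sfun : forall m, sdom m -> proj (sfun m) = m;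
  sfun_smooth : forall k : triv Z,
    smooth_fun (sdom `&` tdom k) (fun m => avsub (sfun m) (tsec k m)) }.

(* The pairs (m, sigma), with sigma a section defined around m. *)
Record psection {R : realType} {n : nat} {M : atlas R n} (Z : avbundle M) := PSection {
  pt : M;
  sec : lsection Z;
  pt_sdom : sdom sec pt }.

(* The set of classes of an equivalence relation. *)
Section Quotient.
Context {T : Type} (e : T -> T -> Prop).

Definition quot := {c : set T | exists x, c = e x}.
Definition cls (x : T) : quot := exist _ (e x) (ex_intro _ x erefl).
Definition qrepr (c : quot) : T := sval (cid (svalP c)).

Lemma qreprK c : cls (qrepr c) = c.
Proof.
case: c => c cP; apply: eq_exist => /=; rewrite /qrepr /=.
by case: cid => x /= ->.
Qed.

Hypotheses (e_refl : forall x, e x x) (e_sym : forall x y, e x y -> e y x)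
  (e_trans : forall x y z, e x y -> e y z -> e x z).

Lemma clsP x y : cls x = cls y <-> e x y.
Proof.
split=> [/(congr1 sval)/= exy|xy]; first by rewrite exy; exact: e_refl.
apply: eq_exist => /=; apply/seteqP; split=> z /= ?; first exact: e_trans (e_sym xy) _.
exact: e_trans xy _.
Qed.

Lemma qrepr_cls x : e (qrepr (cls x)) x.
Proof. by apply/clsP; rewrite qreprK. Qed.

End Quotient.

Section Sections.
Context {R : realType} {n : nat} {M : atlas R n} {Z : avbundle M}.
Implicit Types (z : Z) (s : lsection Z).

Lemma avsubB z z' w : proj z = proj w -> proj z' = proj w ->
  avsub z z' = avsub z w - avsub z' w.
Proof.
move=> zw z'w; have := avsubK zw; have := avsubK z'w.
set a := avsub z' w; set b := avsub z w => <- <-.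
by rewrite -[in LHS](subrK a b) addrC -avaddA avaddK.
Qed.

Lemma avsubxx z : avsub z z = 0.
Proof. by rewrite -{1}(avadd0 z) avaddK. Qed.

Lemma avaddsub z w r : proj z = proj w -> avsub (avadd z r) w = avsub z w + r.
Proof.
move=> zw; rewrite -{1}(avsubK zw) avaddA avaddK //.
Qed.

Lemma lsec_sub_smooth s s' :
  smooth_fun (sdom s `&` sdom s') (fun m => avsub (s m) (s' m)).
Proof.
apply: smooth_fun_near => m [ms ms']; have [k mk] := tdom_cover Z m.
exists (sdom s `&` sdom s' `&` tdom k).
have oU : open (sdom s `&` sdom s' `&` tdom k).
  by apply: openI; [apply: openI; exact: sdom_open|exact: tdom_open].
split=> //.
apply: (@smooth_fun_ext _ _ _ _ _
  (fun x => avsub (s x) (tsec k x) - avsub (s' x) (tsec k x))) => //.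
  move=> x; rewrite inE => -[[xs xs'] xk].
  by apply: avsubB; rewrite proj_tsec // proj_sfun.
apply: smooth_funB => //.
  by apply: smooth_fun_sub (@sfun_smooth _ _ _ _ s k) => x [[]].
by apply: smooth_fun_sub (@sfun_smooth _ _ _ _ s' k) => x [[]].
Qed.

Lemma lsec_sub_at s s' m : sdom s m -> sdom s' m ->
  smooth_at (fun x => avsub (s x) (s' x)) m.
Proof.
move=> ms ms'; exists (sdom s `&` sdom s'); split=> //; last exact: lsec_sub_smooth.
by apply: openI; exact: sdom_open.
Qed.

Lemma lsec_dpartB i a s1 s2 s3 m : dom i m -> sdom s1 m -> sdom s2 m -> sdom s3 m ->
  dpart i a (fun x => avsub (s1 x) (s2 x)) m =
  dpart i a (fun x => avsub (s1 x) (s3 x)) m - dpart i a (fun x => avsub (s2 x) (s3 x)) m.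
Proof.
move=> mi m1 m2 m3; rewrite -dpartB //; [|exact: lsec_sub_at..].
apply: (@dpart_near _ _ _ _ _ (sdom s1 `&` sdom s2 `&` sdom s3)) => //.
  by do ?apply: openI; exact: sdom_open.
by move=> x; rewrite inE => -[[? ?] ?]; apply: avsubB; rewrite !proj_sfun.
Qed.

Lemma lsec_dpartxx i a s m : dom i m -> sdom s m ->
  dpart i a (fun x => avsub (s x) (s x)) m = 0.
Proof. by move=> mi ms; rewrite (lsec_dpartB a mi ms ms ms) subrr. Qed.

Definition tlsec (k : triv Z) : lsection Z :=
  LSection (@tdom_open _ _ _ Z k) (@proj_tsec _ _ _ Z k) (@tsec_smooth _ _ _ Z k).

Fact lsec_add_proj s r m : sdom s m -> proj (avadd (s m) r) = m.
Proof. by move=> ms; rewrite proj_avadd proj_sfun. Qed.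

Fact lsec_add_smooth s r k :
  smooth_fun (sdom s `&` tdom k) (fun m => avsub (avadd (s m) r) (tsec k m)).
Proof.
have oU : open (sdom s `&` tdom k).
  by apply: openI; [exact: sdom_open|exact: tdom_open].
apply: (@smooth_fun_ext _ _ _ _ _ (fun m => avsub (s m) (tsec k m) + cst r m)) => //.
  by move=> m; rewrite inE => -[? ?]; rewrite avaddsub // proj_tsec // proj_sfun.
by apply: smooth_funD => //; [exact: sfun_smooth|exact: smooth_fun_cst].
Qed.

Definition lsec_add s r : lsection Z :=
  LSection (@sdom_open _ _ _ _ s) (@lsec_add_proj s r) (@lsec_add_smooth s r).

Definition phase_rel (x y : psection Z) : Prop :=
  pt x = pt y /\ dzero (fun m => avsub (sec y m) (sec x m)) (pt x).

Lemma phase_rel_refl x : phase_rel x x.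
Proof. by split=> // i mi a; rewrite lsec_dpartxx //; exact: pt_sdom. Qed.

Lemma phase_rel_dpart x y i a : phase_rel x y -> dom i (pt x) ->
  forall s, sdom s (pt x) ->
  dpart i a (fun m => avsub (sec x m) (s m)) (pt x) =
  dpart i a (fun m => avsub (sec y m) (s m)) (pt x).
Proof.
move=> [xy /[swap] mi /(_ _ mi a) H] s ms; apply/eqP; rewrite eq_sym -subr_eq0.
by rewrite -lsec_dpartB ?H //; [rewrite xy|]; exact: pt_sdom.
Qed.

Lemma phase_rel_sym x y : phase_rel x y -> phase_rel y x.
Proof.
move=> xy; have [pxy _] := xy; split=> // i; rewrite -pxy => mi a.
have ys : sdom (sec y) (pt x) by rewrite pxy; exact: pt_sdom.
by rewrite (phase_rel_dpart a xy mi ys) lsec_dpartxx.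
Qed.

Lemma phase_rel_trans x y w : phase_rel x y -> phase_rel y w -> phase_rel x w.
Proof.
move=> xy yz; have [pxy _] := xy; have [pyz dyz] := yz; split; first by rewrite pxy.
move=> i mi a.
have xs : sdom (sec x) (pt x) by exact: pt_sdom.
have ys : sdom (sec y) (pt x) by rewrite pxy; exact: pt_sdom.
have zs : sdom (sec w) (pt x) by rewrite pxy pyz; exact: pt_sdom.
have mi' : dom i (pt y) by rewrite -pxy.
have xs' : sdom (sec x) (pt y) by rewrite -pxy.
have := phase_rel_dpart a yz mi' xs'; rewrite -pxy => <-.
by rewrite -(phase_rel_dpart a xy mi xs) lsec_dpartxx.
Qed.

Definition phase_pt := quot phase_rel.

Definition base (p : phase_pt) : M := pt (qrepr p).

Definition psec (p : phase_pt) : lsection Z := sec (qrepr p).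

Definition dsec (s : lsection Z) (m : M) (ms : sdom s m) : phase_pt :=
  cls phase_rel (PSection ms).

Definition phase_clsP := clsP phase_rel_refl phase_rel_sym phase_rel_trans.

Lemma phase_qrepr x : phase_rel (qrepr (cls phase_rel x)) x.
Proof. exact: (qrepr_cls phase_rel_refl phase_rel_sym phase_rel_trans). Qed.

Definition psec_base p : sdom (psec p) (base p) := pt_sdom (qrepr p).

Lemma base_dsec s m (ms : sdom s m) : base (dsec ms) = m.
Proof. by case: (phase_qrepr (PSection ms)). Qed.

Lemma dsec_psec p : dsec (psec_base p) = p.
Proof. by rewrite -[RHS]qreprK /dsec /psec_base /psec /base; case: (qrepr p). Qed.

Lemma psec_dpart i a s m (ms : sdom s m) t : dom i m -> sdom t m ->
  dpart i a (fun x => avsub (psec (dsec ms) x) (t x)) m =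
  dpart i a (fun x => avsub (s x) (t x)) m.
Proof.
move=> mi mt; have := phase_qrepr (PSection ms) => /= H; have [/= E _] := H.
by have := @phase_rel_dpart _ _ i a H; rewrite E; apply.
Qed.

Lemma dsec_eq i (s t : lsection Z) m (ms : sdom s m) (mt : sdom t m) : dom i m ->
  (forall a, dpart i a (fun x => avsub (t x) (s x)) m = 0) -> dsec ms = dsec mt.
Proof.
move=> mi H; apply/phase_clsP; split=> //=; apply: dzero_chart H => //.
exact: lsec_sub_at.
Qed.

End Sections.

Section PhaseAtlas.
Context {R : realType} {n : nat} {M : atlas R n} (Z : avbundle M).
Implicit Types (p : phase_pt (Z := Z)) (i j : chart M) (k l : triv Z).

(* A chart of M and a trivialisation tsec k of Z induce a chart of the phase
   bundle: d sigma (m) has the coordinates x^a (m) and d (sigma - tsec k) / d x^a (m). *)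
Definition phase_dom (c : chart M * triv Z) : set (phase_pt (Z := Z)) :=
  [set p | dom c.1 (base p) /\ tdom c.2 (base p)].

Definition phase_coord (c : chart M * triv Z) (p : phase_pt (Z := Z)) : 'rV[R]_(n + n) :=
  row_mx (coord c.1 (base p))
    (\row_a dpart c.1 a (fun m => avsub (psec p m) (tsec c.2 m)) (base p)).

Fact phase_cover p : exists c, phase_dom c p.
Proof.
have [i mi] := dom_cover (base p); have [k mk] := tdom_cover Z (base p).
by exists (i, k).
Qed.

Fact phase_coord_inj c : set_inj (phase_dom c) (phase_coord c).
Proof.
case: c => i k p q; rewrite !inE => -[/= pi pk] [/= qi qk] /eq_row_mx[].
move/(coord_injP pi qi) => pq /rowP dpq.
have qs : sdom (psec q) (base p) by rewrite pq; exact: psec_base.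
rewrite -(dsec_psec p) -[q]dsec_psec.
have -> : dsec (psec_base q) = dsec qs.
  by move: (qs); rewrite pq => qs'; congr dsec; exact: Prop_irrelevance.
apply: (@dsec_eq _ _ _ _ i _ _ _ _ _ pi) => a; have ps := psec_base p.
rewrite (lsec_dpartB (s3 := tlsec k) _ pi) //.
by apply/eqP; rewrite subr_eq0; have := dpq a; rewrite !mxE -pq => ->.
Qed.

(* The section over a chart domain whose differential has components q. *)
Definition affsec_fun i k (q : 'rV[R]_n) (m : M) : Z :=
  avadd (tsec k m) (\sum_a q 0 a * coord i m 0 a).

Let affdom i k : set M := dom i `&` tdom k.

Fact affsec_open i k : open (affdom i k).
Proof. by apply: openI; [exact: dom_open|exact: tdom_open]. Qed.

Fact affsec_proj i k q m : affdom i k m -> proj (affsec_fun i k q m) = m.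
Proof. by move=> [mi mk]; rewrite proj_avadd proj_tsec. Qed.

Lemma afffun_smooth i (q : 'rV[R]_n) : smooth_fun (dom i) (fun m => \sum_a q 0 a * coord i m 0 a).
Proof.
apply: smooth_fun_sum; first exact: dom_open.
move=> a; apply: smooth_funM; first exact: dom_open; last exact: coord_smooth.
by apply: (@smooth_fun_cst _ _ _ _ (q 0 a)); exact: dom_open.
Qed.

Fact affsec_smooth i k q l :
  smooth_fun (affdom i k `&` tdom l) (fun m => avsub (affsec_fun i k q m) (tsec l m)).
Proof.
have oU : open (affdom i k `&` tdom l).
  by apply: openI; [exact: affsec_open|exact: tdom_open].
apply: (@smooth_fun_ext _ _ _ _ _ (fun m => avsub (tsec k m) (tsec l m) +
   \sum_a q 0 a * coord i m 0 a)) => //.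
  by move=> m; rewrite inE => -[[mi mk] ml]; rewrite avaddsub // !proj_tsec.
apply: smooth_funD => //.
  by apply: smooth_fun_sub (@tsec_smooth _ _ _ Z k l) => m [[]].
by apply: smooth_fun_sub (@afffun_smooth i q) => m [[]].
Qed.

Definition affsec i k q : lsection Z :=
  LSection (@affsec_open i k) (@affsec_proj i k q) (@affsec_smooth i k q).

Lemma affsec_dpart i k q a m : dom i m -> tdom k m ->
  dpart i a (fun x => avsub (affsec i k q x) (tsec k x)) m = q 0 a.
Proof.
move=> mi mk.
have -> : (fun x => avsub (affsec i k q x) (tsec k x)) =
   fun x => \sum_a q 0 a * coord i x 0 a.
  by apply/funext => x; rewrite avaddK.
rewrite -[RHS](_ : \sum_b q 0 b * (a == b)%:R = _); last first.
  rewrite (bigD1 a) //= eqxx mulr1 big1 ?addr0 // => b /negbTE.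
  by rewrite eq_sym => ->; rewrite mulr0.
transitivity (pd a (fun y : 'rV[R]_n => \sum_b q 0 b * y 0 b) (coord i m)).
  apply: pd_near; apply: (@open_eq_near _ _ (coord i @` (setT `&` dom i))).
  - by apply: img_open; exact: openT.
  - by exists m.
  - by move=> y; rewrite inE => -[x [_ xi] <-]; rewrite repE.
rewrite (_ : (fun y => _) = \sum_b (q 0 b *: (fun y : 'rV[R]_n => y 0 b))); last first.
  by apply/funext => y; rewrite fct_sumE.
rewrite /pd derive_sum; last first.
  by move=> b; apply: derivableZ; apply: diff_derivable; exact: differentiable_coord.
apply: eq_bigr => b _; rewrite deriveZ; last first.
  by apply: diff_derivable; exact: differentiable_coord.
by congr (_ * _); exact: pd_coord.
Qed.

Lemma phase_image i k (U : set M) :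
  phase_coord (i, k) @` ([set p | U (base p)] `&` phase_dom (i, k)) =
  lsubmx @^-1` (coord i @` (U `&` tdom k `&` dom i)).
Proof.
apply/seteqP; split=> [_ [p [/= Up [pi pk]] <-]|y [m [[Um mk] mi] my]] /=.
  by rewrite row_mxKl; exists (base p).
pose s := affsec i k (rsubmx y).
have ms : sdom s m by [].
have b : base (dsec ms) = m by exact: base_dsec.
exists (dsec ms); first by rewrite /phase_dom /= !b.
rewrite /phase_coord /= b -[RHS]hsubmxK my; congr row_mx.
by apply/rowP => a; rewrite mxE (@psec_dpart _ _ _ _ i a s m ms (tlsec k)) // affsec_dpart.
Qed.

Lemma phase_preim_open i k (U : set M) : open U ->
  open (lsubmx @^-1` (coord i @` (U `&` tdom k `&` dom i)) : set 'rV[R]_(n + n)).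
Proof.
move=> oU; apply: open_comp => [y _|]; first exact: continuous_lsubmx.
by apply: img_open; apply: openI => //; exact: tdom_open.
Qed.

Lemma phase_domI i k j l : phase_dom (i, k) `&` phase_dom (j, l) =
  [set p | (dom j `&` tdom l) (base p)] `&` phase_dom (i, k).
Proof. by rewrite setIC. Qed.

Fact phase_overlap c d : open (phase_coord c @` (phase_dom c `&` phase_dom d)).
Proof.
case: c d => [i k] [j l]; rewrite phase_domI phase_image; apply: phase_preim_open.
by apply: openI; [exact: dom_open|exact: tdom_open].
Qed.

Lemma smooth_on_lsub i (U : set M) (f : M -> R) :
  open (lsubmx @^-1` (coord i @` (U `&` dom i)) : set 'rV[R]_(n + n)) ->
  smooth_fun U f ->
  smooth_on (lsubmx @^-1` (coord i @` (U `&` dom i)) : set 'rV[R]_(n + n))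
    (rep i f \o lsubmx).
Proof.
move=> oU /(_ i) sf; apply: smooth_on_comp sf => // c.
rewrite (_ : (fun y => _) = (fun y : 'rV[R]_(n + n) => y 0 (lshift n c))); last first.
  by apply/funext => y; rewrite mxE.
exact: smooth_on_coord.
Qed.

Fact phase_transition c d (A : 'I_(n + n)) :
  smooth_on (phase_coord c @` (phase_dom c `&` phase_dom d))
    (localrep (phase_dom c) (phase_coord c) (fun p => phase_coord d p 0 A)).
Proof.
case: c d => [i k] [j l]; set O := (X in smooth_on X).
have oO : open O by exact: phase_overlap.
pose W := dom j `&` tdom l `&` tdom k.
have oW : open W.
  by apply: openI; [apply: openI; [exact: dom_open|exact: tdom_open]|exact: tdom_open].
have OE : O = lsubmx @^-1` (coord i @` (W `&` dom i)) by rewrite /O phase_domI phase_image.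
have lsm f : smooth_fun W f -> smooth_on O (rep i f \o lsubmx).
  by move=> sf; rewrite OE; apply: smooth_on_lsub => //; rewrite -OE.
have pO y : y \in O -> exists p, [/\ phase_dom (i, k) p, phase_dom (j, l) p & y = phase_coord (i, k) p].
  by rewrite inE => -[p [? ?] <-]; exists p.
case: (split_ordP A) => b ->.
  apply: (@smooth_on_eq _ _ _ _ (rep i (fun m => coord j m 0 b) \o lsubmx)) => //.
    move=> y /pO[p [[pi pk] [pj pl] ->]] /=.
    rewrite localrepE //; last exact: phase_coord_inj.
    by rewrite !row_mxKl repE // /phase_coord row_mxEl.
  apply: lsm; apply: smooth_fun_sub (@coord_smooth _ _ _ j b).
  by move=> m [[]].
have sW : W `&` dom i `<=` dom i by move=> m [].
pose g a (m : M) := dpart i a (fun x => avsub (tsec k x) (tsec l x)) m.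
pose h a (m : M) := dpart j b (fun x => coord i x 0 a) m.
apply: (@smooth_on_eq _ _ _ _ (fun y => \sum_a (y 0 (rshift n a) +
   (rep i (g a) \o lsubmx) y) * (rep i (h a) \o lsubmx) y)) => //.
  move=> y /pO[p [[/= pi pk] [/= pj pl] ->]] /=.
  rewrite localrepE //; last exact: phase_coord_inj.
  rewrite /phase_coord row_mxEr row_mxKl !mxE /=.
  rewrite (dpart_chain b pj pi); last first.
    by apply: (@lsec_sub_at _ _ _ _ (psec p) (tlsec l)) => //; exact: psec_base.
  apply: eq_bigr => a _; rewrite !repE //; congr (_ * _).
  rewrite row_mxEr mxE.
  rewrite (@lsec_dpartB _ _ _ _ i a (psec p) (tlsec l) (tlsec k)) //; last exact: psec_base.
  have -> : g a (base p) = - dpart i a (fun x => avsub (tlsec l x) (tlsec k x)) (base p).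
    apply/eqP; rewrite -addr_eq0 /g; apply/eqP.
    by rewrite (@lsec_dpartB _ _ _ _ i a (tlsec l) (tlsec k) (tlsec l)) //
      lsec_dpartxx // sub0r subrr.
  by [].
apply: smooth_on_sum => // a; apply: smooth_onM => //.
  apply: smooth_onD => //; first exact: smooth_on_coord.
  rewrite OE -[dom i]setIid setIA; apply: smooth_on_lsub.
    by rewrite -setIA setIid -OE.
  apply: dpart_smooth => //; first by apply: openI => //; exact: dom_open.
  by apply: smooth_fun_sub (@tsec_smooth _ _ _ Z k l) => m [[[? ?] ?] ?].
rewrite OE -[dom i]setIid setIA; apply: smooth_on_lsub.
  by rewrite -setIA setIid -OE.
apply: dpart_smooth; first by apply: openI => //; exact: dom_open.
- by move=> m [[[? ?] ?] ?].
- by apply: smooth_fun_sub (@coord_smooth _ _ _ i a) => m [].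
Qed.

Definition phase : atlas R (n + n) :=
  Atlas phase_cover phase_coord_inj phase_overlap phase_transition.

Lemma base_open (U : set M) : open U -> open ([set p | U (base p)] : set phase).
Proof.
move=> oU; rewrite atlas_openE => -[i k].
by rewrite /= phase_image; exact: phase_preim_open.
Qed.

Lemma base_smooth (U : set M) f : open U -> smooth_fun U f ->
  smooth_fun ([set p | U (base p)] : set phase) (f \o @base R n M Z).
Proof.
move=> oU sf [i k].
have oW : open (U `&` tdom k) by apply: openI => //; exact: tdom_open.
apply: (@smooth_on_eq _ _ _ _ (rep i f \o lsubmx)).
- by rewrite phase_image; exact: phase_preim_open.
- move=> y; rewrite inE => -[p [Up [pi pk]] <-].
  by rewrite (@repE _ _ phase (i, k) _ p) //= row_mxKl repE.
- rewrite phase_image; apply: smooth_on_lsub; first exact: phase_preim_open.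
  by apply: smooth_fun_sub sf => m [].
Qed.

Lemma base_at f (p : phase) : smooth_at f (base p) -> smooth_at (M := phase) (f \o @base R n M Z) p.
Proof.
move=> [U [oU Up sf]]; exists [set q | U (base q)]; split => //.
  exact: base_open.
exact: base_smooth.
Qed.

Lemma base_dpart i k (A : 'I_(n + n)) f (p : phase) :
  dom i (base p) -> tdom k (base p) -> smooth_at f (base p) ->
  dpart (M := phase) (i, k) A (f \o @base R n M Z) p =
  match fintype.split A with inl a => dpart i a f (base p) | inr _ => 0 end.
Proof.
move=> pi pk sf; rewrite /dpart.
rewrite (@pd_near _ _ _ (rep i f \o lsubmx)); last first.
  apply: (@open_eq_near _ _ (@coord _ _ phase (i, k) @` ([set: phase] `&` @dom _ _ phase (i, k)))).
  - by apply: (@img_open _ _ phase); exact: openT.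
  - by exists p.
  - move=> y; rewrite inE => -[q [_ [/= qi qk]] <-].
    by rewrite (@repE _ _ phase (i, k)) //= row_mxKl repE.
have cE c : (fun y : 'rV[R]_(n + n) => (lsubmx y : 'rV_n) 0 c) = (fun y => y 0 (lshift n c)).
  by apply/funext => y; rewrite mxE.
rewrite pd_comp; first last.
- by rewrite /= row_mxKl; exact: smooth_at_rep.
- by move=> c; rewrite cE; exact: differentiable_coord.
rewrite /= row_mxKl; under eq_bigr => c _ do rewrite cE pd_coord.
case: fintype.split_ordP => b ->.
  rewrite (bigD1 b) // big1 => [|c /negbTE cb].
    by rewrite eqxx mulr1 [LHS]addr0.
  by rewrite eq_lshift eq_sym cb mulr0.
by rewrite big1 // => c _; rewrite eq_rlshift mulr0.
Qed.

End PhaseAtlas.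

Section Contact.
Context {R : realType} {n : nat} {M : atlas R n} (Z : avbundle M).
Implicit Types (x y w : psection Z) (s : lsection Z) (p : phase Z).

(* Equality of first jets. *)
Definition contact_rel x y : Prop :=
  [/\ pt x = pt y, sec x (pt x) = sec y (pt x) &
      dzero (fun m => avsub (sec y m) (sec x m)) (pt x)].

Lemma contact_relP x y :
  contact_rel x y <-> phase_rel x y /\ sec x (pt x) = sec y (pt x).
Proof. by split=> [[? ? ?]|[[? ?] ?]]. Qed.

Lemma contact_rel_refl x : contact_rel x x.
Proof. by apply/contact_relP; split=> //; exact: phase_rel_refl. Qed.

Lemma contact_rel_sym x y : contact_rel x y -> contact_rel y x.
Proof.
move=> /contact_relP[xy vxy]; apply/contact_relP; split; first exact: phase_rel_sym.
by case: xy => <- _.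
Qed.

Lemma contact_rel_trans x y w : contact_rel x y -> contact_rel y w -> contact_rel x w.
Proof.
move=> /contact_relP[xy vxy] /contact_relP[yw vyw]; apply/contact_relP; split.
  exact: phase_rel_trans yw.
by rewrite vxy; case: xy => -> _.
Qed.

Definition contact_pt := quot contact_rel.

Implicit Type c : contact_pt.

Definition jet s m (ms : sdom s m) : contact_pt := cls contact_rel (PSection ms).

Definition contact_clsP := clsP contact_rel_refl contact_rel_sym contact_rel_trans.

Lemma contact_qrepr x : contact_rel (qrepr (cls contact_rel x)) x.
Proof. exact: (qrepr_cls contact_rel_refl contact_rel_sym contact_rel_trans). Qed.

Definition mu c : Z := sec (qrepr c) (pt (qrepr c)).

Definition contact_proj c : phase Z := dsec (pt_sdom (qrepr c)).

Definition contact_add c (r : R) : contact_pt :=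
  jet (s := lsec_add (sec (qrepr c)) r) (pt_sdom (qrepr c)).

Definition contact_sub c c' : R := avsub (mu c) (mu c').

Lemma PSection_eta x : PSection (pt_sdom x) = x.
Proof. by case: x. Qed.

Lemma mu_cls x : mu (cls contact_rel x) = sec x (pt x).
Proof. by case: (contact_qrepr x) => E1 E2 _; rewrite /mu E2 E1. Qed.

Lemma contact_proj_cls x : contact_proj (cls contact_rel x) = cls phase_rel x.
Proof.
apply/phase_clsP; rewrite PSection_eta.
by case/contact_relP: (contact_qrepr x).
Qed.

Lemma mu_jet s m (ms : sdom s m) : mu (jet ms) = s m.
Proof. exact: mu_cls. Qed.

Lemma contact_proj_jet s m (ms : sdom s m) : contact_proj (jet ms) = dsec ms.
Proof. exact: contact_proj_cls. Qed.

Lemma dsec_add s m (ms : sdom s m) r : dsec (s := lsec_add s r) ms = dsec ms.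
Proof.
have [i mi] := dom_cover m.
apply/esym; apply: (@dsec_eq _ _ _ _ i s (lsec_add s r) m ms ms mi) => a.
have E : (fun m' => avsub (lsec_add s r m') (s m')) = cst r.
  by apply/funext => m'; exact: avaddK.
by rewrite E dpart_cst.
Qed.

Lemma contact_proj_add c r : contact_proj (contact_add c r) = contact_proj c.
Proof. by rewrite contact_proj_jet dsec_add. Qed.

Lemma mu_add c r : mu (contact_add c r) = avadd (mu c) r.
Proof. exact: mu_jet. Qed.

Lemma proj_mu c : proj (mu c) = base (contact_proj c).
Proof. by rewrite /mu /contact_proj base_dsec proj_sfun //; exact: pt_sdom. Qed.

Lemma contact_ext c c' : contact_proj c = contact_proj c' -> mu c = mu c' -> c = c'.
Proof.
rewrite -(qreprK c) -(qreprK c') !contact_proj_cls !mu_cls.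
move=> /phase_clsP cc' E; apply/contact_clsP/contact_relP; split => //.
by rewrite E; case: cc' => ->.
Qed.

Fact contact_add0 c : contact_add c 0 = c.
Proof. by apply: contact_ext; rewrite ?contact_proj_add // mu_add avadd0. Qed.

Fact contact_addA c r t : contact_add (contact_add c r) t = contact_add c (r + t).
Proof. by apply: contact_ext; rewrite ?contact_proj_add // !mu_add avaddA. Qed.

Fact contact_subK c c' : contact_proj c = contact_proj c' ->
  contact_add c' (contact_sub c c') = c.
Proof.
move=> cc'; apply: contact_ext; first by rewrite contact_proj_add.
by rewrite mu_add avsubK // !proj_mu cc'.
Qed.

Fact contact_addK c r : contact_sub (contact_add c r) c = r.
Proof. by rewrite /contact_sub mu_add avaddK. Qed.

(* The point of the fibre of contact_proj over p that mu maps to s (base p), see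
   proj_mupull, mu_mupull and mupull_unique. *)
Definition mupull (s : M -> Z) p : contact_pt :=
  jet (s := lsec_add (psec p) (avsub (s (base p)) (psec p (base p)))) (psec_base p).

Lemma proj_mupull (s : M -> Z) p : contact_proj (mupull s p) = p.
Proof. by rewrite contact_proj_jet dsec_add dsec_psec. Qed.

Lemma mu_mupull (s : M -> Z) p : proj (s (base p)) = base p -> mu (mupull s p) = s (base p).
Proof.
by move=> sp; rewrite mu_jet /= avsubK // sp proj_sfun //; exact: psec_base.
Qed.

Lemma mupull_unique s p c : sdom s (base p) ->
  contact_proj c = p -> mu c = s (base p) -> c = mupull s p.
Proof.
move=> ms cp cs; apply: contact_ext; first by rewrite proj_mupull.
by rewrite mu_mupull // proj_sfun.
Qed.

Lemma sub_mupull (s t : M -> Z) p : proj (s (base p)) = base p -> proj (t (base p)) = base p ->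
  contact_sub (mupull s p) (mupull t p) = avsub (s (base p)) (t (base p)).
Proof. by move=> sp tp; rewrite /contact_sub !mu_mupull. Qed.

Definition contact_tdom (k : triv Z) : set (phase Z) := [set p | tdom k (base p)].

Definition contact_tsec (k : triv Z) : phase Z -> contact_pt := mupull (tsec k).

Fact contact_tdom_open k : open (contact_tdom k).
Proof. by apply: base_open; exact: tdom_open. Qed.

Fact contact_cover p : exists k, contact_tdom k p.
Proof. exact: tdom_cover. Qed.

Lemma mupull_smooth s t (U : set M) : open U -> U `<=` sdom s `&` sdom t ->
  smooth_fun ([set p | U (base p)] : set (phase Z))
    (fun p => contact_sub (mupull s p) (mupull t p)).
Proof.
move=> oU Ust; apply: (@smooth_fun_ext _ _ (phase Z) _ _
   ((fun m => avsub (s m) (t m)) \o @base R n M Z)); first exact: base_open.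
  by move=> p; rewrite inE => /Ust[? ?]; rewrite sub_mupull // proj_sfun.
apply: base_smooth => //; apply: smooth_fun_sub Ust _; exact: lsec_sub_smooth.
Qed.

Fact contact_tsec_smooth k l : smooth_fun (contact_tdom k `&` contact_tdom l)
  (fun p => contact_sub (contact_tsec k p) (contact_tsec l p)).
Proof.
apply: (@mupull_smooth (tlsec k) (tlsec l) (tdom k `&` tdom l)) => //.
by apply: openI; exact: tdom_open.
Qed.

(* c sigma (m) |-> d sigma (m); the trivialisations are pulled back along mu. *)
Definition contact : avbundle (phase Z) :=
  @AVBundle R (n + n) (phase Z) contact_pt contact_proj contact_add contact_sub
    contact_proj_add contact_add0 contact_addA contact_subK contact_addK
    (triv Z) contact_tdom contact_tsec contact_tdom_open contact_cover
    (fun k p _ => proj_mupull (tsec k) p) contact_tsec_smooth.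

Fact lpull_open s : open ([set p | sdom s (base p)] : set (phase Z)).
Proof. by apply: base_open; exact: sdom_open. Qed.

Fact lpull_smooth s (k : triv contact) :
  smooth_fun (([set p | sdom s (base p)] : set (phase Z)) `&` tdom k)
    (fun p => avsub (mupull s p : contact) (tsec k p)).
Proof.
have oU : open (sdom s `&` tdom (k : triv Z)).
  by apply: openI; [exact: sdom_open|exact: tdom_open].
exact: (@mupull_smooth s (tlsec (k : triv Z)) _ oU).
Qed.

(* The pull-back of s along mu. *)
Definition lpull s : lsection contact :=
  @LSection _ _ _ contact [set p | sdom s (base p)] (mupull s) (@lpull_open s)
    (fun p _ => proj_mupull s p) (@lpull_smooth s).

End Contact.

Section Affine.
Context {R : realType} {n : nat} {M : atlas R n}.

(* Smooth sections of the phase bundle. *)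
Record affine_form (Z : avbundle M) := AffineForm {
  aform :> M -> phase Z;
  base_aform : forall m, base (aform m) = m;
  aform_smooth : forall (i : chart M) (k : triv Z) (a : 'I_n),
    smooth_fun (dom i `&` tdom k) (fun m => @coord _ _ (phase Z) (i, k) (aform m) 0 (rshift n a)) }.

(* The class p is represented by psec p; the value does not depend on the
   representative, see liouville_affineE. *)
Definition liouville_fun (Z : avbundle M) (p : phase Z) : phase (contact Z) :=
  dsec (s := lpull (psec p)) (m := p) (psec_base p).

Lemma liouville_dpart Z (p : phase Z) i k (l : triv Z) A :
  dom i (base p) -> tdom k (base p) -> tdom l (base p) ->
  @dpart _ _ (phase Z) (i, k) A
    (fun q => @avsub _ _ _ (contact Z) (psec (liouville_fun p) q) (@tsec _ _ _ (contact Z) l q)) p =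
  match fintype.split A with
  | inl a => dpart i a (fun m => avsub (psec p m) (tsec l m)) (base p)
  | inr _ => 0 end.
Proof.
move=> pi pk pl.
have -> := @psec_dpart _ _ (phase Z) (contact Z) (i, k) A (lpull (psec p)) p
  (psec_base p) (tlsec (Z := contact Z) l) (conj pi pk) pl.
have pU : (sdom (psec p) `&` tdom l) (base p) by split=> //; exact: psec_base.
have oU : open (sdom (psec p) `&` tdom l).
  by apply: openI; [exact: sdom_open|exact: tdom_open].
rewrite (@dpart_near _ _ (phase Z) (i, k) A [set q | (sdom (psec p) `&` tdom l) (base q)]
  _ ((fun m => avsub (psec p m) (tsec l m)) \o @base R n M Z)) //.
- rewrite base_dpart //; apply: (@lsec_sub_at _ _ _ _ (psec p) (tlsec l)) => //.
  exact: psec_base.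
- exact: base_open.
- move=> q; rewrite inE => -[qs ql].
  by apply: sub_mupull; rewrite ?proj_sfun ?proj_tsec.
Qed.

Fact base_liouville Z (p : phase Z) : base (liouville_fun p) = p.
Proof. exact: base_dsec. Qed.

End Affine.

Section Liouville.
Context {R : realType} {n : nat} {M : atlas R n} (Z : avbundle M).

Fact liouville_smooth (i : chart (phase Z)) (l : triv (contact Z)) (A : 'I_(n + n)) :
  smooth_fun (dom i `&` tdom l) (fun p : phase Z =>
    @coord _ _ (phase (contact Z)) (i, l) (liouville_fun p) 0 (rshift (n + n) A)).
Proof.
have oU : open (dom i `&` tdom l).
  by apply: openI; [exact: dom_open|exact: tdom_open].
case: i oU => i k oU.
have coordE (p : phase Z) : (@dom _ _ (phase Z) (i, k) `&` @tdom _ _ _ (contact Z) l) p ->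
  @coord _ _ (phase (contact Z)) ((i, k), l) (liouville_fun p) 0 (rshift (n + n) A) =
  match fintype.split A with
  | inl a => dpart i a (fun m => avsub (psec p m) (tsec (l : triv Z) m)) (base p)
  | inr _ => 0 end.
  move=> [[/= pi pk] pl].
  by rewrite row_mxEr mxE base_liouville; exact: liouville_dpart.
case: (fintype.split_ordP A) => a AE.
  pose W := dom i `&` tdom k `&` tdom (l : triv Z).
  have oW : open W.
    by apply: openI; [apply: openI; [exact: dom_open|exact: tdom_open]|exact: tdom_open].
  apply: (@smooth_fun_ext _ _ (phase Z) _ _ (fun p =>
    @coord _ _ (phase Z) (i, k) p 0 (rshift n a) +
    (dpart i a (fun m => avsub (tsec k m) (tsec (l : triv Z) m)) \o @base R n M Z) p)) => //.
    move=> p; rewrite inE => pU; rewrite coordE //; move: pU => -[[/= pi pk] pl].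
    rewrite AE (unsplitK (inl a)) row_mxEr mxE.
    rewrite (@lsec_dpartB _ _ _ _ i a (psec p) (tlsec (l : triv Z)) (tlsec k)) //; last exact: psec_base.
    congr (_ + _).
    rewrite (@lsec_dpartB _ _ _ _ i a (tlsec k) (tlsec (l : triv Z)) (tlsec k)) //.
    by rewrite lsec_dpartxx // sub0r.
  apply: smooth_funD => //.
    by apply: smooth_fun_sub (@coord_smooth _ _ (phase Z) (i, k) _) => p [].
  have sub : @dom _ _ (phase Z) (i, k) `&` @tdom _ _ _ (contact Z) l `<=` ([set p | W (base p)] : set (phase Z)).
    by move=> p [[? ?] ?].
  apply: smooth_fun_sub sub _; apply: base_smooth => //.
  apply: dpart_smooth => //; first by move=> m [[]].
  by apply: smooth_fun_sub (@tsec_smooth _ _ _ Z k l) => m [[]].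
apply: (@smooth_fun_ext _ _ (phase Z) _ _ (cst 0)) => //; last exact: smooth_fun_cst.
by move=> p; rewrite inE => pU; rewrite coordE // AE (unsplitK (inr a)).
Qed.

Definition liouville_affine : affine_form (contact Z) :=
  AffineForm (@base_liouville R n M Z) liouville_smooth.

Lemma liouville_affineE (s : lsection Z) (m : M) (ms : sdom s m)
    (ms' : sdom (lpull s) (dsec ms)) :
  liouville_affine (dsec ms) = dsec ms'.
Proof.
have [[i k] [pi pk]] := dom_cover (dsec ms : phase Z).
have ps := psec_base (dsec ms).
apply: (@dsec_eq _ _ (phase Z) (contact Z) (i, k) (lpull (psec (dsec ms))) (lpull s)
  (dsec ms) _ _ (conj pi pk)) => A.
rewrite (@dpart_near _ _ (phase Z) (i, k) A
  [set q | (sdom s `&` sdom (psec (dsec ms))) (base q)]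
  _ ((fun m => avsub (s m) (psec (dsec ms) m)) \o @base R n M Z)) //.
- rewrite base_dpart //; last exact: lsec_sub_at.
  case: fintype.split => // a.
  rewrite (@lsec_dpartB _ _ _ _ i a s (psec (dsec ms)) s) //.
  move: pi ms' ps; rewrite base_dsec => pi ms' ps.
  by rewrite psec_dpart // subrr.
- by apply: base_open; apply: openI; exact: sdom_open.
- move=> q; rewrite inE => -[qs ql].
  by apply: sub_mupull; rewrite ?proj_sfun.
Qed.

End Liouville.

Section Trivial.
Context {R : realType} {n : nat} (M : atlas R n).

Let tot : Type := (M * R)%type.
Let tpr (z : tot) : M := z.1.
Let tadd (z : tot) (r : R) : tot := (z.1, z.2 + r).
Let tsub (z w : tot) : R := z.2 - w.2.

Fact trivial_add0 z : tadd z 0 = z. Proof. by case: z => m r; rewrite /tadd addr0. Qed.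
Fact trivial_addA z r s : tadd (tadd z r) s = tadd z (r + s).
Proof. by rewrite /tadd /= addrA. Qed.
Fact trivial_subK z w : tpr z = tpr w -> tadd w (tsub z w) = z.
Proof. by case: z w => [m r] [m' r'] /= ->; rewrite /tadd /tsub /= addrC subrK. Qed.
Fact trivial_addK z r : tsub (tadd z r) z = r.
Proof. by rewrite /tsub /= addrC addKr. Qed.
Fact trivial_smooth (k l : unit) : smooth_fun ([set: M] `&` [set: M])
  (fun m => tsub (m, 0) (m, 0)).
Proof.
have oT : open ([set: M] `&` [set: M]) by rewrite setIT; exact: openT.
apply: (@smooth_fun_ext _ _ _ _ _ (cst 0)) => //; last exact: smooth_fun_cst.
by move=> m _; rewrite /tsub subrr.
Qed.

Definition trivial_av : avbundle M :=
  @AVBundle R n M tot tpr tadd tsub (fun _ _ => erefl) trivial_add0 trivial_addA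
    trivial_subK trivial_addK unit (fun=> setT) (fun _ m => (m, 0)) (fun=> openT)
    (fun=> ex_intro _ tt I) (fun _ _ _ => erefl) trivial_smooth.

(* For Z = M * R the sections are the functions on M, and d f (m) is the class of f
   modulo functions with the same first derivatives at m: the phase bundle is T^*M,
   with coordinates x^a and p_a = d f / d x^a. *)
Definition cotangent : atlas R (n + n) := phase trivial_av.

Definition zero_section : lsection trivial_av := tlsec (tt : triv trivial_av).

End Trivial.

Section Difference.
Context {R : realType} {n : nat} {M : atlas R n} {Z : avbundle M}.
Implicit Types s t : lsection Z.

Fact lsec_diff_open s t : open (sdom s `&` sdom t).
Proof. by apply: openI; exact: sdom_open. Qed.

Fact lsec_diff_smooth s t (k : triv (trivial_av M)) :
  smooth_fun (sdom s `&` sdom t `&` tdom k)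
    (fun m => avsub ((m, avsub (s m) (t m)) : trivial_av M) (tsec k m)).
Proof.
apply: (@smooth_fun_ext _ _ _ _ _ (fun m => avsub (s m) (t m))).
- by apply: openI; [exact: lsec_diff_open|exact: tdom_open].
- by move=> m _; rewrite /= subr0.
- apply: smooth_fun_sub (@lsec_sub_smooth _ _ _ _ s t); exact: subIsetl.
Qed.

Definition lsec_diff s t : lsection (trivial_av M) :=
  @LSection _ _ _ (trivial_av M) _ (fun m => (m, avsub (s m) (t m)))
    (@lsec_diff_open s t) (fun _ _ => erefl) (@lsec_diff_smooth s t).

(* The covector p - d s (m), for p over a point m of the domain of s; the zero
   covector is a dummy value for the other points p, see phase_sub_dsec. *)
Definition phase_sub (p : phase Z) (s : lsection Z) : cotangent M :=
  match pselect (sdom s (base p)) with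
  | left ps => dsec (s := lsec_diff (psec p) s) (conj (psec_base p) ps)
  | right _ => dsec (s := zero_section M) (m := base p) I
  end.

Lemma base_phase_sub p s : base (phase_sub p s) = base p.
Proof. by rewrite /phase_sub; case: pselect => ?; rewrite base_dsec. Qed.

Lemma phase_sub_dsec s t m (ms : sdom s m) (mt : sdom t m) (mst : sdom (lsec_diff s t) m) :
  phase_sub (dsec ms) t = dsec mst.
Proof.
rewrite /phase_sub; case: pselect => [mt'|]; last by rewrite base_dsec.
have [i mi] := dom_cover m.
set h := conj _ _; move: h; set s' := psec (dsec ms).
have s'E : forall a, dpart i a (fun x => avsub (s' x) (t x)) m = dpart i a (fun x => avsub (s x) (t x)) m.
  by move=> a; exact: psec_dpart.
move: s'E; move: s'; rewrite base_dsec => s' s'E h.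
apply: (@dsec_eq _ _ M (trivial_av M) i (lsec_diff s' t) (lsec_diff s t) m) => // a.
rewrite (@lsec_dpartB _ _ M (trivial_av M) i a (lsec_diff s t) (lsec_diff s' t) (zero_section M)) //=.
have E (u : lsection Z) : (fun x : M => avsub (u x) (t x) - 0) = (fun x => avsub (u x) (t x)).
  by apply/funext => x; rewrite subr0.
by rewrite !E s'E subrr.
Qed.

End Difference.

Section Forms.
Context {R : realType}.

(* A tangent vector at m is an element of the dual of T^*_m M, i.e. a linear
   functional on functions f smooth around m that only depends on d f (m).  Its
   values on functions that are not smooth around m are irrelevant. *)
Definition tvec {n} (M : atlas R n) := (M -> R) -> R.

Definition tangent {n} {M : atlas R n} (m : M) (v : tvec M) : Prop :=
  (forall f g r, smooth_at f m -> smooth_at g m ->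
     v (fun x => r * f x + g x) = r * v f + v g) /\
  (forall f, smooth_at f m -> dzero f m -> v f = 0).

Definition coordvec {n} {M : atlas R n} (i : chart M) (a : 'I_n) (m : M) : tvec M :=
  fun f => dpart i a f m.

Lemma coordvec_tangent {n} {M : atlas R n} (i : chart M) (a : 'I_n) (m : M) :
  dom i m -> tangent m (coordvec i a m).
Proof.
move=> mi; split=> [f g r sf sg|f _ /(_ i mi)]; last exact.
have sr : smooth_at (fun x => r * f x) m.
  have [U [oU Um ?]] := sf; exists U; split=> //.
  by apply: smooth_funM => //; exact: (smooth_fun_cst r).
rewrite /coordvec dpartD //; congr (_ + _).
rewrite /dpart -[RHS]/(r *: _) -deriveZ; last first.
  by apply: diff_derivable; exact: smooth_at_rep.
apply: pd_near; apply: (@open_eq_near _ _ (coord i @` (setT `&` dom i))).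
- by apply: img_open; exact: openT.
- by exists m.
- by move=> y; rewrite inE => -[x [_ xi] <-]; rewrite [LHS]repE // -[RHS]/(r * rep i f (coord i x)) repE.
Qed.

(* d f (m) applied to v is v f. *)
Definition pairing {n} {M : atlas R n} (xi : cotangent M) (v : tvec M) : R :=
  v (fun m => (psec xi m).2).

(* Forms are given by their values on tangent vectors; the values on functionals
   that are not tangent at the point are irrelevant, whence eq_form2. *)
Definition form1 {n} (M : atlas R n) := M -> tvec M -> R.
Definition form2 {n} (M : atlas R n) := M -> tvec M -> tvec M -> R.

Definition eq_form2 {n} {M : atlas R n} (om om' : form2 M) : Prop :=
  forall m v w, tangent m v -> tangent m w -> om m v w = om' m v w.

Definition chart_at {n} {M : atlas R n} (m : M) : chart M := sval (cid (dom_cover m)).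

(* d (al_b dx^b) = d_a al_b dx^a /\ dx^b, computed in a chart around the point, with
   (dx^a /\ dx^b) (v, w) = v^a w^b - v^b w^a. *)
Definition dform1 {n} {M : atlas R n} (al : form1 M) : form2 M := fun m v w =>
  let i := chart_at m in
  let x (a : 'I_n) (y : M) := coord i y 0 a in
  \sum_a \sum_b dpart i a (fun y => al y (coordvec i b y)) m
    * (v (x a) * w (x b) - v (x b) * w (x a)).

Definition push {n p} {M : atlas R n} {N : atlas R p} (F : M -> N) (v : tvec M) : tvec N :=
  fun f => v (f \o F).

Definition pull2 {n p} {M : atlas R n} {N : atlas R p} (F : M -> N) (om : form2 N) : form2 M :=
  fun m v w => om (F m) (push F v) (push F w).

(* p_a dx^a in a canonical chart around the point. *)
Definition liouville_form {n} (M : atlas R n) : form1 (cotangent M) := fun xi v =>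
  let c := chart_at xi in
  \sum_(a < n) coord c xi 0 (rshift n a) * v (fun eta => coord c eta 0 (lshift n a)).

Definition lsec_at {n} {M : atlas R n} (Z : avbundle M) (m : M) : lsection Z :=
  tlsec (sval (cid (tdom_cover Z m))).

(* d al = d (al - d sigma), for a local section sigma of Z around the point. *)
Definition dform_aff {n} {M : atlas R n} {Z : avbundle M} (al : affine_form Z) : form2 M :=
  fun m => dform1 (fun x => pairing (phase_sub (aform al x) (lsec_at Z m))) m.

(* The pull-back of the differential of p_a dx^a along q |-> q - d sigma, for a local
   section sigma of Z around base p. *)
Definition symplectic_form {n} {M : atlas R n} (Z : avbundle M) : form2 (phase Z) :=
  fun p => pull2 (fun q => phase_sub q (lsec_at Z (base p))) (dform1 (@liouville_form n M)) p.

Arguments symplectic_form {n M} Z.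

End Forms.

Arguments symplectic_form {R n M} Z.

(* Main.v *)
Require Import Defs.
From HB Require Import structures.
From mathcomp Require Import all_boot all_order all_algebra.
From mathcomp Require Import all_classical all_reals topology normedtype landau derive.
From mathcomp Require Import ring.

(* Let s be a local section of Z, and let (x^a, p_a) be the coordinates on the phase
   bundle given by a chart of M and s.  The class of theta_Z at p minus d (mu^* s) is
   the differential at p of the function (sigma - s) o base, where p = d sigma (m);
   its components are p_a along dx^a and 0 along dp_a.  Hence both sides are
   dp_a /\ dx^a.  They are computed in unrelated charts, so it remains to see that
   dp_a /\ dx^a does not depend on the chart of M, which follows from the symmetry of
   the second derivatives of the transition functions. *)

Set Implicit Arguments.
Unset Strict Implicit.
Unset Printing Implicit Defensive.

Import Order.TTheory GRing.Theory Num.Theory numFieldNormedType.Exports.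
(* [coord] must denote the charts of Defs, not the coordinates of vector.v. *)
Import Defs.
Local Open Scope classical_set_scope.
Local Open Scope ring_scope.

(** * Symmetry of second directional derivatives *)

Section SymmetricDerivatives.
Context {R : realType} {V : normedModType R}.
Implicit Types (f : V -> R) (x u v : V).

Lemma is_derive_line f x u (s : R) : differentiable f (s *: u + x) ->
  is_derive s 1 (fun t : R => f (t *: u + x)) ('D_u f (s *: u + x)).
Proof.
move=> df; have [dl lE] : is_diff s (fun t : R => t *: u + x) ( *:%R^~ u).
  have := is_diffD (is_diff_scalel s u) (is_diff_cst x s).
  by rewrite addr0.
have dc : differentiable (fun t : R => f (t *: u + x)) s.
  exact: (@differentiable_comp _ _ _ _ (fun t : R => t *: u + x) f).
apply: DeriveDef; first exact: diff_derivable.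
rewrite deriveE // (@diff_comp _ _ _ _ (fun t : R => t *: u + x) f) //= deriveE //.
by rewrite lE scale1r.
Qed.

(* Mean value theorem for s |-> f (s u + h v + x) - f (s u + x), whose derivative is
   estimated by the differentiability of 'D_u f at x. *)
Lemma second_difference f x u v (e : R) : 0 < e ->
  (\forall y \near x, differentiable f y) -> differentiable ('D_u f) x ->
  \forall h \near (0 : R)^'+,
    `|f (h *: u + (h *: v + x)) - f (h *: v + x) - (f (h *: u + x) - f x)
      - h ^+ 2 * 'D_v ('D_u f) x| <= e * h ^+ 2.
Proof.
move=> e0 df ddf.
(* All increments [s *: u + t *: v] with [s], [t] in [0, h] have norm at most [h * (]|u| + [|v|)],
   hence below [h * K]; the summand 1 keeps [K] positive when [u = v = 0]. The factor 2 in [e'] is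
   for the two remainders that are added at the end. *)
set K := `|u| + `|v| + 1.
have K0 : 0 < K by rewrite /K; apply: ltr_wpDl => //; apply: addr_ge0.
set e' := e / (2 * K).
have e'0 : 0 < e' by rewrite divr_gt0 // mulr_gt0.
have /eqaddoP/(_ _ e'0) := diff_locally ddf.
move=> /nbhs_normP[/= d1 d10 Hd1].
move: df => /nbhs_normP[/= d2 d20 Hd2].
have hK : \forall h \near (0 : R)^'+, h * K < Num.min d1 d2.
  near=> h; rewrite -ltr_pdivlMr //; near: h.
  by apply: nbhs_right_lt; rewrite divr_gt0 // lt_min d10 d20.
near=> h.
have h0 : 0 < h by near: h; exact: nbhs_right_gt.
have hd : h * K < Num.min d1 d2 by near: h.
have small (s t : R) : 0 <= s <= h -> 0 <= t <= h -> `|s *: u + t *: v| <= h * (`|u| + `|v|).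
  move=> /andP[s0 sh] /andP[t0 th]; apply: (le_trans (ler_normD _ _)).
  rewrite !normrZ mulrDr !ger0_norm //.
  by apply: lerD; apply: ler_wpM2r.
have lt_d (w : V) : `|w| <= h * (`|u| + `|v|) -> `|w| < d1 /\ `|w| < d2.
  move=> wK; apply/andP; rewrite -lt_min; apply: le_lt_trans hd.
  by apply: (le_trans wK); rewrite ler_pM2l // /K lerDl.
have hh : 0 <= h <= h by rewrite lexx ltW.
have h00 : 0 <= (0:R) <= h by rewrite lexx ltW.
have dfs (s t : R) : 0 <= s <= h -> 0 <= t <= h -> differentiable f (s *: u + (t *: v + x)).
  move=> sh th; apply: Hd2; rewrite /ball_ /= -normrN opprB addrA addrK.
  by case: (lt_d _ (small s t sh th)).
have rem (s t : R) : 0 <= s <= h -> 0 <= t <= h ->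
    `|'D_u f (s *: u + (t *: v + x)) - ('D_u f x + 'd ('D_u f) x (s *: u + t *: v))|
      <= e' * (h * (`|u| + `|v|)).
  move=> sh th; have wK := small s t sh th.
  have := Hd1 (s *: u + t *: v); rewrite /ball_ /= sub0r normrN => /(_ (lt_d _ wK).1).
  rewrite (addrA (s *: u)) => /le_trans; apply.
  by rewrite ler_pM2l.
pose phi (s : R) := f (s *: u + (h *: v + x)) - f (s *: u + x).
pose dphi (s : R) := 'D_u f (s *: u + (h *: v + x)) - 'D_u f (s *: u + x).
have dphiE s : 0 <= s <= h -> is_derive s (1:R) phi (dphi s).
  move=> sh; apply: is_deriveB; apply: is_derive_line; first exact: dfs.
  by have := dfs s 0 sh h00; rewrite scale0r add0r.
have [s||c] := @MVT_segment R phi dphi 0 h (ltW h0).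
- by rewrite in_itv /= => /andP[s0 sh]; apply: dphiE; rewrite !ltW.
- apply: derivable_within_continuous => s /=; rewrite in_itv /= => sh.
  by have [] := dphiE s sh.
rewrite in_itv /= => ch; rewrite /phi !scale0r !add0r subr0.
rewrite opprB [X in X = _ -> _]addrACA -opprD [X in _ - X]addrC => E.
have {}E : f (h *: u + (h *: v + x)) - f (h *: v + x) - (f (h *: u + x) - f x) = dphi c * h.
  by rewrite -E opprB; ring.
rewrite E.
have -> : 'D_v ('D_u f) x = 'd ('D_u f) x v by rewrite deriveE.
have r1 := rem c h ch hh.
have r2 := rem c 0 ch h00.
rewrite !scale0r ?add0r ?addr0 in r2.
have dE : 'd ('D_u f) x (c *: u + h *: v) = 'd ('D_u f) x (c *: u) + h * 'd ('D_u f) x v.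
  by rewrite linearD !linearZ.
rewrite dE in r1.
(* The left side is [h] times the difference of two remainders, those of the expansion of ['D_u f]
   at [c *: u + h *: v] and at [c *: u]: the terms linear in [c *: u] cancel. *)
have -> : dphi c * h - h ^+ 2 * 'd ('D_u f) x v =
  h * (('D_u f (c *: u + (h *: v + x)) - ('D_u f x + ('d ('D_u f) x (c *: u) + h * 'd ('D_u f) x v)))
     - ('D_u f (c *: u + x) - ('D_u f x + 'd ('D_u f) x (c *: u)))).
  by rewrite /dphi; ring.
rewrite normrM gtr0_norm // [e * _]mulrC expr2 -mulrA ler_pM2l //.
apply: (le_trans (ler_normB _ _)); apply: (le_trans (lerD r1 r2)).
have -> : e' * (h * (`|u| + `|v|)) + e' * (h * (`|u| + `|v|)) = h * e * ((`|u| + `|v|) / K).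
  by rewrite /e'; field; rewrite gt_eqF.
rewrite ler_piMr ?mulr_ge0 ?ltW // ltr_pdivrMr // mul1r /K ltrDl ltr01 //.
Unshelve. all: by end_near. Qed.

(** The second difference is symmetric in [u] and [v], so for one small [h > 0] both mixed
    derivatives, multiplied by [h ^+ 2], lie within [e / 2 * h ^+ 2] of the same number. *)
Lemma derive_comm f x u v : (\forall y \near x, differentiable f y) ->
  differentiable ('D_u f) x -> differentiable ('D_v f) x ->
  'D_v ('D_u f) x = 'D_u ('D_v f) x.
Proof.
move=> df du dv; apply/eqP; rewrite -subr_eq0 -normr_le0; apply/ler_addgt0Pr => e e0.
rewrite add0r; have e20 : 0 < e / 2 by rewrite divr_gt0.
have key (k A B D : R) : 0 < k -> `|D - k * A| <= e / 2 * k ->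
    `|D - k * B| <= e / 2 * k -> `|A - B| <= e.
  move=> k0 HA HB; rewrite -(ler_pM2l k0) -{1}(gtr0_norm k0) -normrM.
  have -> : k * (A - B) = (D - k * B) - (D - k * A) by ring.
  have -> : k * e = e / 2 * k + e / 2 * k by field.
  by apply: (le_trans (ler_normB _ _)); exact: lerD.
have Huv := second_difference v e20 df du; have Hvu := second_difference u e20 df dv.
have [h [{}Huv [{}Hvu h0]]] := filter_ex (filterI Huv (filterI Hvu (nbhs_right_gt 0))).
apply: key Huv _; first exact: exprn_gt0.
move: Hvu; rewrite (addrCA (h *: v)).
set a := f (h *: u + (h *: v + x)); set b := f (h *: u + x); set c := f (h *: v + x).
by have -> : a - b - (c - f x) = a - c - (b - f x) by ring.
Qed.

End SymmetricDerivatives.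

(** * Tangent functionals and exterior derivatives in a chart *)

Section Tangent.
Context {R : realType} {n : nat} {M : atlas R n}.
Implicit Types (i c : chart M) (f g : M -> R) (m : M) (v : tvec M).

Lemma smooth_at_coord i a m : dom i m -> smooth_at (fun x => coord i x 0 a) m.
Proof. by exists (dom i); split=> //; [exact: dom_open|exact: coord_smooth]. Qed.

Lemma smooth_atM f g m : smooth_at f m -> smooth_at g m -> smooth_at (fun x => f x * g x) m.
Proof.
by move=> sf /(smooth_atI sf)[U [oU Um ? ?]]; exists U; split=> //; exact: smooth_funM.
Qed.

Lemma smooth_at_near (U : set M) f g m : open U -> U m -> {in U, f =1 g} ->
  smooth_at g m -> smooth_at f m.
Proof.
move=> oU Um fg [V [oV Vm sg]]; have oUV := openI oU oV; exists (U `&` V); split=> //.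
apply: smooth_fun_ext (smooth_fun_sub (@subIsetr _ U V) sg) => //.
by move=> x; rewrite inE => -[Ux _]; apply: fg; rewrite inE.
Qed.

Lemma smooth_at_dpart i a f m : dom i m -> smooth_at f m -> smooth_at (dpart i a f) m.
Proof.
move=> mi [U [oU Um sf]]; have oW : open (U `&` dom i) by apply: openI => //; exact: dom_open.
exists (U `&` dom i); split=> //.
by apply: dpart_smooth => //; exact: smooth_fun_sub sf.
Qed.

Lemma dpartM i a f g m : dom i m -> smooth_at f m -> smooth_at g m ->
  dpart i a (fun x => f x * g x) m = f m * dpart i a g m + g m * dpart i a f m.
Proof.
move=> mi sf sg; rewrite -{1}(repE f mi) -{1}(repE g mi) /dpart.
rewrite -pdM; [|exact: smooth_at_rep..].
apply: pd_near; apply: (@open_eq_near _ _ (coord i @` (setT `&` dom i))).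
- by apply: img_open; exact: openT.
- by exists m.
- by move=> y; rewrite inE => -[x [_ xi] <-]; rewrite fctE !repE.
Qed.

Lemma dpart_comm i a b f m : dom i m -> smooth_at f m ->
  dpart i a (dpart i b f) m = dpart i b (dpart i a f) m.
Proof.
move=> mi [U [oU Um sf]].
have oI : open (coord i @` (U `&` dom i)) by exact: img_open.
have Im : (coord i @` (U `&` dom i)) (coord i m) by exists m.
have pdpd e d : dpart i e (dpart i d f) m = pd e (pd d (rep i f)) (coord i m).
  apply: pd_near; apply: (@open_eq_near _ _ (coord i @` (U `&` dom i))) => //.
  by move=> y; rewrite inE => -[x [_ xi] <-]; rewrite repE.
rewrite !pdpd; apply: derive_comm.
- have := open_nbhs_nbhs (conj oI Im); apply: filterS => y Iy.
  exact: smooth_on_diff (sf i) Iy.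
- by apply: smooth_on_diff (smooth_on_pd b (sf i)) _.
- by apply: smooth_on_diff (smooth_on_pd a (sf i)) _.
Qed.

(** Smoothness and value go through one induction: [v] is linear only on functions smooth at [m], so
    each step needs the smoothness of the remaining sum. *)
Lemma tangent_sum m v (I : Type) (r : seq I) (k : I -> R) (F : I -> M -> R) :
  tangent m v -> (forall b, smooth_at (F b) m) ->
  smooth_at (fun x => \sum_(b <- r) k b * F b x) m /\
  v (fun x => \sum_(b <- r) k b * F b x) = \sum_(b <- r) k b * v (F b).
Proof.
move=> [vD v0] sF; elim: r => [|a r [IHs IHv]].
  have -> : (fun x => \sum_(b <- [::]) k b * F b x) = cst 0.
    by apply/funext => x; rewrite big_nil.
  split; first exact: smooth_at_cst.
  rewrite big_nil v0 //; first exact: smooth_at_cst.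
  by move=> i mi a; exact: dpart_cst.
have -> : (fun x => \sum_(b <- a :: r) k b * F b x) =
    (fun x => k a * F a x + \sum_(b <- r) k b * F b x).
  by apply/funext => x; rewrite big_cons.
split; last by rewrite vD // IHv big_cons.
by apply: smooth_atD => //; apply: smooth_atM => //; exact: (smooth_at_cst m (k a)).
Qed.

(** The difference of [f] and its linear part [g] in the chart has zero differential at [m], so [v]
    kills it. *)
Lemma tangentE c f m v : tangent m v -> dom c m -> smooth_at f m ->
  v f = \sum_a dpart c a f m * v (fun x => coord c x 0 a).
Proof.
move=> tv mc sf; have [vD v0] := tv.
have sc a := smooth_at_coord a mc.
pose g x := \sum_a dpart c a f m * coord c x 0 a.
have [sg <-] := @tangent_sum m v _ (index_enum _) (fun a => dpart c a f m) _ tv sc.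
have fE : f = (fun x => 1 * (f x - g x) + g x) by apply/funext => x; rewrite mul1r subrK.
rewrite [in LHS]fE vD //; last exact: smooth_atB.
rewrite v0 ?mulr0 ?add0r //; first exact: smooth_atB.
apply: (@dzero_chart _ _ _ c) => //; first exact: smooth_atB.
move=> a; rewrite dpartB //.
have [_ gE] := tangent_sum (index_enum _) (fun a => dpart c a f m) (coordvec_tangent a mc) sc.
rewrite -[dpart c a g m]/(coordvec c a m g) gE (bigD1 a) //= big1 ?addr0.
  by rewrite /coordvec dpart_coord // eqxx mulr1 subrr.
by move=> b /negbTE ba; rewrite /coordvec dpart_coord // eq_sym ba mulr0.
Qed.

(** Locality is not built into [tangent]; it comes from [tangentE], since partial derivatives are
    local. *)
Lemma tangent_near (U : set M) f g m v : tangent m v -> open U -> U m -> {in U, f =1 g} ->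
  smooth_at g m -> v f = v g.
Proof.
move=> tv oU Um fg sg; have [c mc] := dom_cover m.
rewrite (tangentE tv mc sg) (tangentE tv mc (smooth_at_near oU Um fg sg)).
by apply: eq_bigr => a _; rewrite (dpart_near a oU Um mc fg).
Qed.

(** The Leibniz rule is likewise inherited from the partial derivatives through [tangentE]. *)
Lemma tangentM f g m v : tangent m v -> smooth_at f m -> smooth_at g m ->
  v (fun x => f x * g x) = f m * v g + g m * v f.
Proof.
move=> tv sf sg; have [c mc] := dom_cover m.
rewrite (tangentE tv mc sf) (tangentE tv mc sg) (tangentE tv mc (smooth_atM sf sg)).
rewrite !mulr_sumr -big_split /=; apply: eq_bigr => a _.
by rewrite dpartM // mulrDl !mulrA.
Qed.

(** Only the coefficients are replaced, so [v] and [w] may be arbitrary functionals, in particular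
    pushed-forward vectors. *)
Lemma dform1_near (al : form1 M) (G : 'I_n -> M -> R) (U : set M) m v w :
  open U -> U m ->
  (forall b, {in U, (fun y => al y (coordvec (chart_at m) b y)) =1 G b}) ->
  dform1 al m v w = \sum_a \sum_b dpart (chart_at m) a (G b) m *
    (v (fun y => coord (chart_at m) y 0 a) * w (fun y => coord (chart_at m) y 0 b) -
     v (fun y => coord (chart_at m) y 0 b) * w (fun y => coord (chart_at m) y 0 a)).
Proof.
move=> oU Um alG; apply: eq_bigr => a _; apply: eq_bigr => b _.
by rewrite (dpart_near a oU Um (svalP (cid (dom_cover m))) (alG b)).
Qed.

(** This is d (G_b dx^b) = dG_b /\ dx^b: by [tangentE] the sum over [a] assembles to [v (G b)] and
    [w (G b)]. *)
Lemma dform1E (al : form1 M) (G : 'I_n -> M -> R) (U : set M) m v w :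
  tangent m v -> tangent m w -> open U -> U m ->
  (forall b, {in U, (fun y => al y (coordvec (chart_at m) b y)) =1 G b}) ->
  (forall b, smooth_at (G b) m) ->
  dform1 al m v w = \sum_b
    (v (G b) * w (fun y => coord (chart_at m) y 0 b) -
     v (fun y => coord (chart_at m) y 0 b) * w (G b)).
Proof.
move=> tv tw oU Um alG sG; rewrite (dform1_near _ _ oU Um alG) exchange_big /=.
have mc : dom (chart_at m) m := svalP (cid (dom_cover m)).
apply: eq_bigr => b _; rewrite (tangentE tv mc (sG b)) (tangentE tw mc (sG b)).
rewrite mulr_suml mulr_sumr -sumrB; apply: eq_bigr => a _; ring.
Qed.

End Tangent.

(** * The form dp_a /\ dx^a on the phase bundle and its independence of the chart *)

Section PhaseForms.
Context {R : realType} {n : nat} {M : atlas R n} {Z : avbundle M}.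
Implicit Types (i j : chart M) (l : triv Z) (p : phase Z) (v w : tvec (phase Z)).

(** A function pulled back from [M] has no derivative along the momenta, so only the x^a
    contribute. *)
Lemma tangent_base i f p v : tangent p v -> dom i (base p) -> smooth_at f (base p) ->
  v (f \o @base R n M Z) =
  \sum_a dpart i a f (base p) * v (fun q => coord i (base q) 0 a).
Proof.
move=> tv pi sf; have [l pl] := tdom_cover Z (base p).
rewrite (@tangentE _ _ (phase Z) (i, l) _ p v tv _ (base_at sf)) //.
rewrite big_split_ord /= [X in _ + X]big1 ?addr0 => [|a _]; last first.
  by rewrite base_dpart // (unsplitK (inr a)) mul0r.
apply: eq_bigr => a _; rewrite base_dpart // (unsplitK (inl a)); congr (_ * v _).
by apply/funext => q; rewrite row_mxEl.
Qed.

(* dp_a /\ dx^a in the coordinates (x^a, p_a) of the chart (i, l). *)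
Definition canonical2 i l v w : R := \sum_(a < n)
  (v (fun q => coord ((i, l) : chart (phase Z)) q 0 (rshift n a)) * w (fun q => coord i (base q) 0 a) -
   v (fun q => coord i (base q) 0 a) * w (fun q => coord ((i, l) : chart (phase Z)) q 0 (rshift n a))).

(** With the trivialisation [l] fixed, the momenta are the components of one covector; the chain
    rule gives their transformation law. *)
Lemma phase_coord_chart i j l b p : dom i (base p) -> dom j (base p) -> tdom l (base p) ->
  coord ((i, l) : chart (phase Z)) p 0 (rshift n b) =
  \sum_a coord ((j, l) : chart (phase Z)) p 0 (rshift n a) *
    dpart i b (fun x => coord j x 0 a) (base p).
Proof.
move=> pi pj pl; rewrite row_mxEr mxE (dpart_chain b pi pj); last first.
  by apply: (@lsec_sub_at _ _ _ _ (psec p) (tlsec l)) => //; exact: psec_base.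
by apply: eq_bigr => a _; rewrite row_mxEr mxE.
Qed.

(** Leibniz rule for the transformation law of the momenta; differentiating the Jacobian produces
    the second derivatives. *)
Lemma tangent_momentum i j l b p v : tangent p v ->
  dom i (base p) -> dom j (base p) -> tdom l (base p) ->
  v (fun q => coord ((i, l) : chart (phase Z)) q 0 (rshift n b)) =
  \sum_a (coord ((j, l) : chart (phase Z)) p 0 (rshift n a) *
      \sum_c dpart i c (dpart i b (fun x => coord j x 0 a)) (base p) *
        v (fun q => coord i (base q) 0 c) +
    dpart i b (fun x => coord j x 0 a) (base p) *
      v (fun q => coord ((j, l) : chart (phase Z)) q 0 (rshift n a))).
Proof.
move=> tv pi pj pl.
pose J a := dpart i b (fun x => coord j x 0 a).
have sJ a : smooth_at (J a) (base p) by apply: smooth_at_dpart => //; exact: smooth_at_coord.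
pose P a (q : phase Z) := coord ((j, l) : chart (phase Z)) q 0 (rshift n a).
have sP a : smooth_at (P a) p by apply: smooth_at_coord.
have sPJ a : smooth_at (fun q => P a q * (J a \o @base R n M Z) q) p.
  by apply: smooth_atM => //; exact: base_at.
have [sS vS] := tangent_sum (index_enum _) (fun=> 1) tv sPJ.
pose W := dom i `&` dom j `&` tdom l.
have oW : open W.
  by apply: openI; [apply: openI; exact: dom_open|exact: tdom_open].
rewrite (@tangent_near _ _ (phase Z) [set q | W (base q)] _ _ p v tv (base_open oW) _ _ sS) //; last first.
  move=> q; rewrite inE => -[[qi qj] ql]; rewrite (phase_coord_chart b qi qj ql).
  by apply: eq_bigr => a _; rewrite mul1r.
rewrite vS; apply: eq_bigr => a _; rewrite mul1r (tangentM tv) //; last exact: base_at.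
by rewrite (tangent_base tv pi) //; exact: sJ.
Qed.

(* The terms with second derivatives of the transition functions cancel by symmetry. *)
Lemma canonical2_chart i j l p v w : tangent p v -> tangent p w ->
  dom i (base p) -> dom j (base p) -> tdom l (base p) ->
  canonical2 i l v w = canonical2 j l v w.
Proof.
move=> tv tw pi pj pl; rewrite /canonical2.
under eq_bigr => b _ do rewrite (tangent_momentum b tv pi pj pl) (tangent_momentum b tw pi pj pl).
have sx a : smooth_at (fun x => coord j x 0 a) (base p) by exact: smooth_at_coord.
under [RHS]eq_bigr => a _.
  rewrite -[fun q => coord j (base q) 0 a]/((fun x => coord j x 0 a) \o @base R n M Z).
  rewrite (tangent_base tv pi (sx a)) (tangent_base tw pi (sx a)).
  over.
set V := fun c => v (fun q => coord i (base q) 0 c).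
set W := fun c => w (fun q => coord i (base q) 0 c).
set P := fun a => coord ((j, l) : chart (phase Z)) p 0 (rshift n a).
set dP := fun a => v (fun q => coord ((j, l) : chart (phase Z)) q 0 (rshift n a)).
set dQ := fun a => w (fun q => coord ((j, l) : chart (phase Z)) q 0 (rshift n a)).
pose J b a := dpart i b (fun x => coord j x 0 a) (base p).
pose H c b a := dpart i c (dpart i b (fun x => coord j x 0 a)) (base p).
have HC c b a : H c b a = H b c a by exact: dpart_comm.
(* The Jacobian terms are the right-hand side expanded in the chart [i]; the terms with second
   derivatives [H] are collected in the other sum. *)
transitivity (\sum_b \sum_a J b a * (dP a * W b - V b * dQ a) +
    \sum_a P a * (\sum_b \sum_c H c b a * (V c * W b - V b * W c))).
  under [X in _ + X]eq_bigr => a _ do rewrite mulr_sumr.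
  rewrite [X in _ + X]exchange_big -big_split /=; apply: eq_bigr => b _.
  rewrite mulr_suml mulr_sumr -sumrB -big_split /=; apply: eq_bigr => a _.
  rewrite -!/(V _) -!/(W _).
  have -> : \sum_c H c b a * (V c * W b - V b * W c) =
      (\sum_c H c b a * V c) * W b - V b * (\sum_c H c b a * W c).
    rewrite mulr_suml mulr_sumr -sumrB; apply: eq_bigr => c _; ring.
  rewrite -/(J b a) -/(P a) -/(dP a) -/(dQ a); ring.
rewrite [X in _ + X]big1 ?addr0 => [|a _]; last first.
  set S := \sum_b _; suff -> : S = 0 by rewrite mulr0.
  (* [H c b a] is symmetric in [b] and [c] while the bracket is antisymmetric, so exchanging the two
     indices changes the sign of [S]. *)
  suff : S = - S by move=> /eqP; rewrite -addr_eq0 -mulr2n mulrn_eq0 => /eqP.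
  rewrite {1}/S exchange_big -sumrN; apply: eq_bigr => b _; rewrite -sumrN.
  by apply: eq_bigr => c _; rewrite HC; ring.
rewrite exchange_big; apply: eq_bigr => a _ /=.
rewrite mulr_sumr mulr_suml -sumrB; apply: eq_bigr => b _.
rewrite -/(J b a) -/(V b) -/(W b) -/(dP a) -/(dQ a); ring.
Qed.

(** Lets the lemmas on differences of sections apply to functions, seen as sections of the trivial
    bundle. *)
Lemma avsub_zero_section (t : lsection (trivial_av M)) :
  (fun x => avsub (t x) (zero_section M x)) = (fun x => (t x).2).
Proof. by apply/funext => x; rewrite /= subr0. Qed.

(** [psec] picks an arbitrary representative of the covector, but its first derivatives at the base
    point depend on the class only. *)
Lemma phase_sub_dpart i a p (s : lsection Z) : dom i (base p) -> sdom s (base p) ->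
  dpart i a (fun x => (psec (phase_sub p s) x).2) (base p) =
  dpart i a (fun x => avsub (psec p x) (s x)) (base p).
Proof.
move=> pi ps.
rewrite -avsub_zero_section /phase_sub; case: pselect => // ps'.
by rewrite (@psec_dpart _ _ _ _ i a _ _ _ (zero_section M)) // avsub_zero_section.
Qed.

End PhaseForms.

(** * The Liouville form of the cotangent bundle in a fixed chart *)

Section Differential.
Context {R : realType} {n : nat} {M : atlas R n}.

(** [liouville_form] uses a chart chosen separately at each [eta]. Before differentiating, its
    components are needed in one fixed chart; the transformation law of the momenta makes them p_b
    again. *)
Lemma liouville_form_coordvec i B (eta : cotangent M) : dom i (base eta) ->
  liouville_form eta (coordvec ((i, tt) : chart (cotangent M)) B eta) =
  match fintype.split B with
  | inl b => coord ((i, tt) : chart (cotangent M)) eta 0 (rshift n b)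
  | inr _ => 0 end.
Proof.
move=> ei; rewrite /liouville_form.
have : dom (chart_at eta) eta := svalP (cid (dom_cover eta)).
case: (chart_at eta) => j [] [/= ej _].
have xE (a : 'I_n) : (fun q : cotangent M => coord ((j, tt) : chart (cotangent M)) q 0 (lshift n a)) =
    (fun x => coord j x 0 a) \o @base R n M (trivial_av M).
  by apply/funext => q; rewrite row_mxEl.
under eq_bigr => a _.
  rewrite xE /coordvec base_dpart //; last exact: smooth_at_coord.
  over.
case: fintype.split => [b|_]; last by rewrite big1 // => a _; rewrite mulr0.
by apply/esym; apply: (@phase_coord_chart _ _ _ (trivial_av M) i j tt b eta ei ej).
Qed.

End Differential.

(** * Both sides computed as dp_a /\ dx^a *)

Section Main.
Context {R : realType} {n : nat} {M : atlas R n} (Z : avbundle M).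

(** In the charts [(i, l)] and [(i, tt)] the map [F] is the identity, so the pushed vectors have the
    same components as [v] and [w]. *)
Lemma symplectic_canonical2 (p : phase Z) (v w : tvec (phase Z)) :
  tangent p v -> tangent p w ->
  symplectic_form Z p v w =
  canonical2 (chart_at (phase_sub p (lsec_at Z (base p)))).1 (sval (cid (tdom_cover Z (base p)))) v w.
Proof.
move=> tv tw; rewrite /symplectic_form /pull2.
set l := sval (cid (tdom_cover Z (base p))); have pl : tdom l (base p) := svalP (cid (tdom_cover Z (base p))).
rewrite -[lsec_at _ _]/(tlsec l).
pose F (q : phase Z) := phase_sub q (tlsec l).
rewrite -/(F _).
have mc : dom (chart_at (F p)) (F p) := svalP (cid (dom_cover (F p))).
set c := chart_at (F p) in mc *; case E: c mc => [i []] [/= pi _].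
pose G (B : 'I_(n + n)) (eta : cotangent M) := match fintype.split B with
  | inl b => coord ((i, tt) : chart (cotangent M)) eta 0 (rshift n b)
  | inr _ => 0 end.
have oU : open ([set q | dom i (base q)] : set (cotangent M)) by apply: base_open; exact: dom_open.
rewrite (dform1_near (G := G) _ _ oU) //; last first.
  move=> B eta; rewrite inE -/c E => ei; exact: liouville_form_coordvec.
rewrite -/c E.
pose x A (eta : cotangent M) := coord ((i, tt) : chart (cotangent M)) eta 0 A.
have xl (u : tvec (phase Z)) a : push F u (x (lshift n a)) = u (fun q => coord i (base q) 0 a).
  rewrite /push; congr u; apply/funext => q.
  by rewrite /= /x row_mxEl /F base_phase_sub.
have xr (u : tvec (phase Z)) a : tangent p u ->
    push F u (x (rshift n a)) = u (fun q => coord ((i, l) : chart (phase Z)) q 0 (rshift n a)).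
  move=> tu; rewrite base_phase_sub in pi.
  pose W := dom i `&` tdom l.
  have oW : open W by apply: openI; [exact: dom_open|exact: tdom_open].
  (* The momenta agree only over [W], since [phase_sub] takes a dummy value outside the domain of
     the section; locality of [u] suffices. *)
  apply: (@tangent_near _ _ (phase Z) [set q | W (base q)] _ _ p u tu (base_open oW)) => //.
    move=> q; rewrite inE => -[qi ql].
    rewrite /= /x !row_mxEr !mxE /F base_phase_sub -(phase_sub_dpart a (s := tlsec l)) //.
    by rewrite -avsub_zero_section.
  exact: smooth_at_coord.
have GE A b : dpart ((i, tt) : chart (cotangent M)) A (G (lshift n b)) (F p) = (A == rshift n b)%:R.
  have -> : G (lshift n b) = x (rshift n b).
    by apply/funext => eta; rewrite /G (unsplitK (inl b)).
  by rewrite dpart_coord.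
have G0 A b : dpart ((i, tt) : chart (cotangent M)) A (G (rshift n b)) (F p) = 0.
  have -> : G (rshift n b) = cst 0.
    by apply/funext => eta; rewrite /G (unsplitK (inr b)).
  by rewrite dpart_cst.
(* The outer index now labels the component of the form: those along dp_b vanish, and the component
   p_b along dx^b varies only in its own direction, which leaves one term for each [b]. *)
rewrite exchange_big big_split_ord /= [X in _ + X]big1 ?addr0 => [|b _]; last first.
  by rewrite big1 // => A _; rewrite G0 mul0r.
apply: eq_bigr => b _; rewrite (bigD1 (rshift n b)) //= big1 ?addr0 => [|A /negbTE Ab]; last first.
  by rewrite GE Ab mul0r.
by rewrite GE eqxx mul1r -!/(x _) !xl !xr.
Qed.

Lemma dform_aff_liouville_canonical2 (p : phase Z) (v w : tvec (phase Z)) :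
  tangent p v -> tangent p w ->
  dform_aff (liouville_affine Z) p v w =
  canonical2 (chart_at p).1 (sval (cid (tdom_cover (contact Z) p)) : triv Z) v w.
Proof.
move=> tv tw; rewrite /dform_aff.
set l : triv Z := sval (cid (tdom_cover (contact Z) p)).
have pl : tdom l (base p) := svalP (cid (tdom_cover (contact Z) p)).
rewrite -[lsec_at _ _]/(tlsec (Z := contact Z) l).
have pc : dom (chart_at p) p := svalP (cid (dom_cover p)).
set c := chart_at p in pc *; case E: c pc => [i k] [/= pi pk].
(* The chart at [p] carries its own trivialisation [k], whereas the momenta here are relative to
   [l], whose pulled-back section is the one subtracted. *)
pose G (B : 'I_(n + n)) (q : phase Z) := match fintype.split B with
  | inl b => coord ((i, l) : chart (phase Z)) q 0 (rshift n b)
  | inr _ => 0 end.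
pose W := dom i `&` tdom k `&` tdom l.
have oW : open W.
  by apply: openI; [apply: openI; [exact: dom_open|exact: tdom_open]|exact: tdom_open].
rewrite (dform1E (G := G) tv tw (base_open oW)) //; first last.
- move=> B; rewrite /G; case: fintype.split => b; last exact: smooth_at_cst.
  exact: smooth_at_coord.
- move=> B q; rewrite inE -/c E => -[[qi qk] ql].
  rewrite /pairing /coordvec.
  have := @phase_sub_dpart _ _ (phase Z) (contact Z) (i, k) B (liouville_affine Z q) (tlsec (Z := contact Z) l).
  rewrite [base _]base_liouville => ->//.
  rewrite liouville_dpart // /G; case: fintype.split => // b.
  by rewrite row_mxEr mxE.
rewrite -/c E big_split_ord /= [X in _ + X]big1 ?addr0 => [|b _]; last first.
  have -> : G (rshift n b) = cst 0.
    by apply/funext => eta; rewrite /G (unsplitK (inr b)).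
  have u0 u : tangent p u -> u (cst 0) = 0.
    move=> [_ -> //]; first exact: smooth_at_cst.
    by move=> d pd a; exact: dpart_cst.
  by rewrite !u0 // mul0r mulr0 subr0.
apply: eq_bigr => b _.
have -> : G (lshift n b) = fun q => coord ((i, l) : chart (phase Z)) q 0 (rshift n b).
  by apply/funext => eta; rewrite /G (unsplitK (inl b)).
(* Only momenta depend on the trivialisation; the position coordinates of [(i, k)] are those of
   [i]. *)
have -> // : (fun q : phase Z => @coord _ _ (phase Z) (i, k) q 0 (lshift n b)) = fun q => coord i (base q) 0 b.
by apply/funext => q; rewrite row_mxEl.
Qed.

End Main.

Theorem theorem16 (R : realType) (n : nat) (M : atlas R n)
    (M_hausdorff : hausdorff_space M) (M_second_countable : @second_countable M)
    (Z : avbundle M) :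
  eq_form2 (dform_aff (liouville_affine Z)) (symplectic_form Z).
Proof.
move=> p v w tv tw.
rewrite (dform_aff_liouville_canonical2 tv tw) (symplectic_canonical2 tv tw).
(* Both sides choose the same local section of Z: contact Z and Z have the same
   trivialisations and, up to the irrelevance of proofs, the same covering proof. *)
have lE : sval (cid (tdom_cover (contact Z) p)) = sval (cid (tdom_cover Z (base p))).
  exact: (congr1 (fun h => sval (cid h)) (Prop_irrelevance _ _)).
rewrite [X in canonical2 _ X]lE.
have [pi _] : dom (chart_at p) p := svalP (cid (dom_cover p)).
set xi := phase_sub _ _.
have [+ _] : dom (chart_at xi) xi := svalP (cid (dom_cover xi)).
rewrite base_phase_sub => xi_dom.
exact: (canonical2_chart tv tw pi xi_dom (svalP (cid (tdom_cover Z (base p))))).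
Qed.
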